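(* Let $n\ge 1$, let $\lambda_1,\dots,\lambda_n,\sigma_1,\dots,\sigma_n\in\mathbb C$, and put $\lambda_{n+1}=\sigma_{n+1}=0$. Assume that $\operatorname{Re}(\lambda_k-\frac{n+k}2+1)>0$ and $\operatorname{Re}(\sigma_k-\lambda_k-\frac{n-k}2)>0$ for $k=1,\dots,n$. Then $$\int_{T+S\in W_n(\mathbb R)}\prod_{j=1}^n\frac{\det[T]_j^{\lambda_j-\lambda_{j+1}}}{\det[1+T+S]_j^{\sigma_j-\sigma_{j+1}}}\,\det T^{-n}\,dT\,dS=\prod_{k=1}^n\frac{\pi^{k-1}\,\Gamma(\lambda_k-\frac{n+k}2+1)\,\Gamma(\sigma_k-\lambda_k-\frac{n-k}2)}{\Gamma(\sigma_k-n+k)} .$$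
   Context: $W_n(\mathbb R)$ is the set of real $n\times n$ matrices $R$ that are dissipative, i.e. $R+R^t$ is positive definite. Each $R$ is written $R=T+S$ with $T=T^t$ positive definite and $S=-S^t$; the integral is over all such pairs $(T,S)$. $[A]_j$ denotes the left upper $j\times j$ block of $A$; $\det[A]_j^{a}$ means $(\det[A]_j)^a$ (all determinants occurring are positive). $dT=\prod_{k\le m}dt_{km}$ and $dS=\prod_{k<m}ds_{km}$ are Lebesgue measures in the independent matrix entries. *)

(* Defs.v *)
From HB Require Import structures.
From mathcomp Require Import all_boot all_order all_algebra.
From mathcomp Require Import all_classical all_reals all_analysis.
From mathcomp Require Import complex.

Set Implicit Arguments.
Unset Strict Implicit.
Unset Printing Implicit Defensive.
Import Order.TTheory GRing.Theory Num.Theory.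

Local Open Scope classical_set_scope.
Local Open Scope ring_scope.
Local Open Scope complex_scope.

Section LebesgueTuple.
Variable R : realType.
Local Notation mR := (measurableTypeR R).

Definition tuple_cons n (p : mR * n.-tuple mR) : n.+1.-tuple mR :=
  [tuple of p.1 :: p.2].

Definition tuple_tail n (x : n.+1.-tuple mR) : n.-tuple mR :=
  [tuple of behead x].

Lemma tuple_consK n (p : mR * n.-tuple mR) : tuple_tail (tuple_cons p) = p.2.
Proof. exact: val_inj. Qed.

Lemma measurable_tuple_cons n : measurable_fun [set: _] (@tuple_cons n).
Proof. exact: measurable_cons. Qed.

Section Step.
Variables (n : nat) (mu : {sigma_finite_measure set (n.-tuple mR) -> \bar R}).

Definition lebesgue_tuple_cons : set (n.+1.-tuple mR) -> \bar R :=
  pushforward (@lebesgue_measure R \x mu)%E (@tuple_cons n).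

Let pushforward_measure :=
  measure_function_pushforward__canonical__measure_function_Measure
    (@lebesgue_measure R \x mu)%E (@measurable_tuple_cons n).

HB.instance Definition _ := isMeasure.Build _ _ _ lebesgue_tuple_cons
  (@measure0 _ _ _ pushforward_measure)
  (@measure_ge0 _ _ _ pushforward_measure)
  (@measure_semi_sigma_additive _ _ _ pushforward_measure).

Let lebesgue_tuple_cons_sigma_finite : sigma_finite setT lebesgue_tuple_cons.
Proof.
have /sigma_finiteP[F [TF ndF Foo]] := sigma_finiteT (@lebesgue_measure R).
have /sigma_finiteP[G [TG ndG Goo]] := sigma_finiteT mu.
exists (fun k => (fun x : n.+1.-tuple mR => thead x) @^-1` F k `&`
                 @tuple_tail n @^-1` G k).
  rewrite predeqE => x; split => // _.
  have [j _ Fj] : (\bigcup_i F i) (thead x) by rewrite -TF.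
  have [k _ Gk] : (\bigcup_i G i) (tuple_tail x) by rewrite -TG.
  exists (maxn j k) => //; split => /=.
    by move: Fj; apply/subsetPset/ndF/leq_maxl.
  by move: Gk; apply/subsetPset/ndG/leq_maxr.
move=> k; have [mF Fk] := Foo k; have [mG Gk] := Goo k; split.
  apply: measurableI; rewrite -[X in measurable X]setTI.
    exact: measurable_tnth.
  exact: measurable_behead.
rewrite /lebesgue_tuple_cons /pushforward.
rewrite (_ : _ @^-1` _ = F k `*` G k); last first.
  by rewrite predeqE => -[a y] /=; rewrite tuple_consK.
by rewrite product_measure1E// lte_mul_pinfty// ge0_fin_numE.
Qed.

HB.instance Definition _ := Measure_isSigmaFinite.Build _ _ _
  lebesgue_tuple_cons lebesgue_tuple_cons_sigma_finite.

End Step.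

(* Lebesgue measure on R^N, as the N-fold product of Lebesgue measure on R. *)
Fixpoint lebesgue_tuple N : {sigma_finite_measure set (N.-tuple mR) -> \bar R} :=
  if N is N'.+1 then lebesgue_tuple_cons (lebesgue_tuple N')
  else dirac [tuple].

End LebesgueTuple.

Section ComplexIntegral.
Context d (T : measurableType d) (R : realType).
Variables (mu : {measure set T -> \bar R}) (D : set T) (f : T -> R[i]).

Definition cintegrable : Prop :=
  mu.-integrable D (fun x => (complex.Re (f x))%:E) /\
  mu.-integrable D (fun x => (complex.Im (f x))%:E).

Definition cintegral : R[i] :=
  (\int[mu]_(x in D) complex.Re (f x)) +i* (\int[mu]_(x in D) complex.Im (f x)).

End ComplexIntegral.

Section ComplexFunctions.
Variable R : realType.

Definition cexp (z : R[i]) : R[i] :=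
  (expR (complex.Re z))%:C * (cos (complex.Im z) +i* sin (complex.Im z)).

(* x ^ a = exp (a ln x), meaningful for x > 0 only. *)
Definition rpowc (x : R) (a : R[i]) : R[i] := cexp (a * (ln x)%:C).

(* Euler's integral; it represents the Gamma function on Re z > 0 only. *)
Definition cGamma (z : R[i]) : R[i] :=
  cintegral (@lebesgue_measure R) `]0, +oo[
    (fun t : R => rpowc t (z - 1) * (expR (- t))%:C).

End ComplexFunctions.

Section Matrices.
Variables (R : realType) (n : nat).

Definition posdefmx (A : 'M[R]_n) : Prop :=
  A^T = A /\ forall v : 'cV[R]_n, v != 0 -> 0 < (v^T *m A *m v) 0 0.

Definition dissipative (A : 'M[R]_n) : Prop := posdefmx (A + A^T).

(* The left upper block of size j.+1. *)
Definition ulblock (A : 'M[R]_n) (j : 'I_n) : 'M[R]_j.+1 :=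
  mxsub (widen_ord (ltn_ord j)) (widen_ord (ltn_ord j)) A.

Definition upper : {set 'I_n * 'I_n} :=
  [set p : 'I_n * 'I_n | (p.1 <= p.2)%N]%SET.

Definition strict_upper : {set 'I_n * 'I_n} :=
  [set p : 'I_n * 'I_n | (p.1 < p.2)%N]%SET.

(* Coordinates indexed by the positions in A, placed at these positions;
   the other entries are 0. *)
Definition mx_of_coords (A : {set 'I_n * 'I_n}) (x : #|A|.-tuple R) : 'M[R]_n :=
  \sum_(k < #|A|) tnth x k *: delta_mx (enum_val k).1 (enum_val k).2.

Definition sym_mx (t : #|upper|.-tuple R) : 'M[R]_n :=
  \matrix_(i, j) (if (i <= j)%N then mx_of_coords t i j
                  else mx_of_coords t j i).

Definition skew_mx (s : #|strict_upper|.-tuple R) : 'M[R]_n :=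
  mx_of_coords s - (mx_of_coords s)^T.

(* dT dS, in the coordinates t_km (k <= m) and s_km (k < m). *)
Definition lebesgue_TS : {measure set _ -> \bar R} :=
  (lebesgue_tuple R #|upper| \x lebesgue_tuple R #|strict_upper|)%E.

End Matrices.

(* Main.v *)
Require Import Defs.
From HB Require Import structures.
From mathcomp Require Import all_boot all_order all_algebra.
From mathcomp Require Import all_classical all_reals all_analysis.
From mathcomp Require Import complex ring lra.

Set Implicit Arguments.
Unset Strict Implicit.
Unset Printing Implicit Defensive.
Import Order.TTheory GRing.Theory Num.Theory.
Import ComplexField.Normc numFieldNormedType.Exports measurable_realfun.

Local Open Scope classical_set_scope.
Local Open Scope ring_scope.
Local Open Scope complex_scope.

(** The proof is by induction on the size, integrating over the last row and
    column. Write the matrices of size [n + 1] as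
    [[T, t; t^T, x]] and [[S, s; - s^T, 0]], and put [A = 1 + T + S] and
    [u = x - t^T T^-1 t]. The bordered symmetric matrix is positive exactly when
    [T] is and [u > 0], and its determinant is [u det T]. The determinant that
    occurs in the denominator is [det A (1 + u + q (s, t))] by [det_border1],
    where the form [q] is positive definite, of determinant
    [1 / (det T (det A) ^ 2)] ([border_form_pos], [det_border_form]).

    For fixed [(T, S)] the integral over the border is therefore that of
    [u ^ (a - 1) (1 + u + q) ^ (- sigma)], with [a = lambda_{n+1} - n] and
    [sigma = sigma_{n+1}]. Writing the second power as
    [1 / Gamma (sigma)] times the integral of
    [y ^ (sigma - 1) e^{- y (1 + u + q)}] over [y > 0] makes it a Gamma integral
    in [u], a Gaussian integral in [(s, t)] and a Gamma integral in [y]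
    ([has_cintegral_border]); its value is
    [pi ^ n Gamma (a) Gamma (sigma - lambda_{n+1}) / Gamma (sigma)], which is the
    last factor of the formula, times [(det T) ^ (1/2) det A]. By
    [radial_fun_border] what remains is the integrand of size [n], each [lambda_k]
    being lowered by 1/2 and each [sigma_k] by 1; these shifts preserve both the
    hypotheses and the other factors of the formula ([radial_formulaS]).

    The computation is carried out with the predicate [has_cintegral], which
    records the integral of the modulus along with the integral, so that each
    use of Fubini's theorem comes with its absolute convergence. The division by
    [Gamma (sigma)] requires that Gamma have no zero on the right half-plane
    ([cGamma_neq0]). The measure enters only through the volumes of boxes
    ([is_lebesgue]), so that [has_cintegral_coords] moves integrals freely between
    the various ways of storing the entries of [(T, S)]. *)

(* Otherwise simplification splits these into real and imaginary parts. *)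
#[global] Arguments normc _ _ : simpl never.
#[global] Arguments rpowc _ _ _ : simpl never.

(** * Complex-valued integrals *)

Section ComplexMeasurable.
Context d (T : measurableType d) (R : realType).
Implicit Types (f g : T -> R[i]).

Definition cmeasurable f :=
  measurable_fun setT (fun x => complex.Re (f x)) /\
  measurable_fun setT (fun x => complex.Im (f x)).

Lemma cmeasurable_cst (c : R[i]) : cmeasurable (fun=> c).
Proof. by split; exact: measurable_cst. Qed.

Lemma cmeasurable_real (f : T -> R) :
  measurable_fun setT f -> cmeasurable (fun x => (f x)%:C).
Proof. by move=> mf; split => //=; exact: measurable_cst. Qed.

Lemma ReM (a b : R[i]) :
  complex.Re (a * b) =
  complex.Re a * complex.Re b - complex.Im a * complex.Im b.
Proof. by case: a b => [a1 a2] [b1 b2]. Qed.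

Lemma ImM (a b : R[i]) :
  complex.Im (a * b) =
  complex.Re a * complex.Im b + complex.Im a * complex.Re b.
Proof. by case: a b => [a1 a2] [b1 b2]. Qed.

Lemma cmeasurableM f g :
  cmeasurable f -> cmeasurable g -> cmeasurable (fun x => f x * g x).
Proof.
move=> [f1 f2] [g1 g2]; split.
  under eq_fun do rewrite ReM.
  by apply: measurable_funB; apply: measurable_funM.
under eq_fun do rewrite ImM.
by apply: measurable_funD; apply: measurable_funM.
Qed.

Lemma cmeasurable_prod (I : Type) (r : seq I) (F : I -> T -> R[i]) :
  (forall i, cmeasurable (F i)) -> cmeasurable (fun x => \prod_(i <- r) F i x).
Proof.
move=> mF; elim: r => [|i r IH].
  by under eq_fun do rewrite big_nil; exact: cmeasurable_cst.
by under eq_fun do rewrite big_cons; exact: cmeasurableM.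
Qed.

Lemma normcE2 (z : R[i]) :
  normc z = Num.sqrt (complex.Re z ^+ 2 + complex.Im z ^+ 2).
Proof. by case: z. Qed.

Lemma normc_ge0 (z : R[i]) : 0 <= normc z.
Proof. by rewrite normcE2 sqrtr_ge0. Qed.

Lemma Re_le_normc (z : R[i]) : `|complex.Re z| <= normc z.
Proof. by rewrite normcE2 -sqrtr_sqr ler_wsqrtr// lerDl sqr_ge0. Qed.

Lemma Im_le_normc (z : R[i]) : `|complex.Im z| <= normc z.
Proof. by rewrite normcE2 -sqrtr_sqr ler_wsqrtr// lerDr sqr_ge0. Qed.

Lemma normc_real (x : R) : normc x%:C = `|x|.
Proof. by rewrite normcE2/= expr0n/= addr0 sqrtr_sqr. Qed.

Lemma measurable_normc f :
  cmeasurable f -> measurable_fun setT (fun x => normc (f x)).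
Proof.
move=> [f1 f2]; under eq_fun do rewrite normcE2.
apply: (@measurableT_comp _ _ _ _ _ _ (@Num.sqrt R)).
  by apply: continuous_measurable_fun; exact: sqrt_continuous.
by apply: measurable_funD; exact: measurable_funX.
Qed.

End ComplexMeasurable.

Lemma cmeasurable_comp d1 d2 (T1 : measurableType d1) (T2 : measurableType d2)
    (R : realType) (f : T2 -> R[i]) (h : T1 -> T2) :
  cmeasurable f -> measurable_fun setT h -> cmeasurable (fun x => f (h x)).
Proof.
move=> [f1 f2] mh; split.
  exact: (@measurableT_comp _ _ _ _ _ _ (fun x => complex.Re (f x))).
exact: (@measurableT_comp _ _ _ _ _ _ (fun x => complex.Im (f x))).
Qed.

Section HasIntegral.
Context d (T : measurableType d) (R : realType).
Implicit Types (mu nu : {measure set T -> \bar R}) (f g : T -> R[i]).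

(** Besides the value [v] of the integral of [f], the record keeps the value
    [w] of the integral of its modulus: tracking both along an iterated
    integration makes absolute convergence a byproduct of the computation. *)
Record has_cintegral mu f (v : R[i]) (w : R) : Prop := HasCIntegral {
  hasc_measurable : cmeasurable f ;
  hasc_normc : (\int[mu]_x (normc (f x))%:E = w%:E)%E ;
  hasc_Re : (\int[mu]_x (complex.Re (f x))%:E = (complex.Re v)%:E)%E ;
  hasc_Im : (\int[mu]_x (complex.Im (f x))%:E = (complex.Im v)%:E)%E }.

Lemma hasc_integrable_normc mu f v w : has_cintegral mu f v w ->
  mu.-integrable setT (fun x => (normc (f x))%:E).
Proof.
case=> mf If _ _; apply/integrableP; split.
  by apply/measurable_EFinP; exact: measurable_normc.
rewrite (_ : (fun x => _) = (fun x => (normc (f x))%:E)) ?If ?ltry//.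
by apply/funext => x; rewrite gee0_abs// lee_fin normc_ge0.
Qed.

Lemma normc_integrable_Re mu f : cmeasurable f ->
  mu.-integrable setT (fun x => (normc (f x))%:E) ->
  mu.-integrable setT (fun x => (complex.Re (f x))%:E).
Proof.
move=> [f1 f2]; apply: le_integrable => //; first exact/measurable_EFinP.
by move=> x _; rewrite /= lee_fin (ger0_norm (normc_ge0 _)) Re_le_normc.
Qed.

Lemma normc_integrable_Im mu f : cmeasurable f ->
  mu.-integrable setT (fun x => (normc (f x))%:E) ->
  mu.-integrable setT (fun x => (complex.Im (f x))%:E).
Proof.
move=> [f1 f2]; apply: le_integrable => //; first exact/measurable_EFinP.
by move=> x _; rewrite /= lee_fin (ger0_norm (normc_ge0 _)) Im_le_normc.
Qed.

Lemma has_cintegral_ext mu f g v w :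
  f =1 g -> has_cintegral mu f v w -> has_cintegral mu g v w.
Proof. by move=> /funext ->. Qed.

Lemma has_cintegral0 mu f : (forall x, f x = 0) -> has_cintegral mu f 0 0.
Proof.
move=> /funext ->; split; first exact: cmeasurable_cst.
- by rewrite -[RHS](integral0 mu setT); apply: eq_integral => x _; rewrite normc0.
- exact: integral0.
- exact: integral0.
Qed.

Lemma has_cintegralZ mu f v w c : has_cintegral mu f v w ->
  has_cintegral mu (fun x => c * f x) (c * v) (normc c * w).
Proof.
move=> H; have iN := hasc_integrable_normc H.
have [mf N1 N2 N3] := H.
have iR := normc_integrable_Re mf iN; have iI := normc_integrable_Im mf iN.
split.
- by apply: cmeasurableM => //; exact: cmeasurable_cst.
- under eq_integral do rewrite normcM EFinM.
  by rewrite integralZl// N1.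
- under eq_integral do rewrite ReM EFinB !EFinM.
  rewrite integralB//; [|exact: integrableZl..].
  by rewrite !integralZl// N2 N3 ReM.
- under eq_integral do rewrite ImM EFinD !EFinM.
  rewrite integralD//; [|exact: integrableZl..].
  by rewrite !integralZl// N2 N3 ImM.
Qed.

Lemma has_cintegral_ge0 mu (f : T -> R) (w : R) : (forall x, 0 <= f x) ->
  measurable_fun setT f -> (\int[mu]_x (f x)%:E = w%:E)%E ->
  has_cintegral mu (fun x => (f x)%:C) w%:C w.
Proof.
move=> f0 mf If; split; first exact: cmeasurable_real.
- by under eq_integral do rewrite normc_real ger0_norm//.
- by [].
- exact: integral0.
Qed.

(** Domains of integration are carried as indicator factors, so that all iterated
    integrals run over whole spaces; only the final statement returns to an
    integral over a set. *)
Lemma has_cintegral_restrict mu (D : set T) f v w : measurable D ->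
  has_cintegral mu (fun x => (\1_D x)%:C * f x) v w ->
  cintegrable mu D f /\ cintegral mu D f = v.
Proof.
move=> mD H; have iN := hasc_integrable_normc H.
have [mf N1 N2 N3] := H.
have iR := normc_integrable_Re mf iN; have iI := normc_integrable_Im mf iN.
have RE : (fun x => (complex.Re (f x))%:E) \_ D =
    (fun x => (complex.Re ((\1_D x)%:C * f x))%:E).
  apply/funext => x; rewrite patchE ReM/= mul0r subr0 indicE.
  by case: ifPn; rewrite ?mul1r ?mul0r.
have IE : (fun x => (complex.Im (f x))%:E) \_ D =
    (fun x => (complex.Im ((\1_D x)%:C * f x))%:E).
  apply/funext => x; rewrite patchE ImM/= mul0r addr0 indicE.
  by case: ifPn; rewrite ?mul1r ?mul0r.
split; first by split; apply/integrable_mkcond => //; rewrite ?RE ?IE.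
rewrite /cintegral /Rintegral [X in fine X +i* _]integral_mkcond RE N2.
by rewrite [X in _ +i* fine X]integral_mkcond IE N3; case: (v).
Qed.

End HasIntegral.

Lemma has_cintegral_pushforward d1 d2 (X : measurableType d1)
    (Y : measurableType d2) (R : realType) (phi : X -> Y)
    (mu : {measure set X -> \bar R}) (nu : {measure set Y -> \bar R})
    (f : Y -> R[i]) v w :
  measurable_fun setT phi ->
  (forall A, measurable A -> mu (phi @^-1` A) = nu A) ->
  cmeasurable f ->
  has_cintegral mu (fun x => f (phi x)) v w <-> has_cintegral nu f v w.
Proof.
move=> mphi E mf.
have ge0E (g : Y -> R) : measurable_fun setT g -> (forall y, 0 <= g y) ->
    (\int[nu]_y (g y)%:E = \int[mu]_x (g (phi x))%:E)%E.
  move=> mg g0.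
  rewrite -(@eq_measure_integral _ _ _ setT nu (pushforward mu phi)).
    rewrite ge0_integral_pushforward//; first exact/measurable_EFinP.
    by move=> y _; rewrite lee_fin.
  by move=> A mA _; exact: E.
have EE (g : Y -> R) : measurable_fun setT g ->
    mu.-integrable setT (fun x => (g (phi x))%:E) ->
    (\int[nu]_y (g y)%:E = \int[mu]_x (g (phi x))%:E)%E.
  move=> mg ig.
  rewrite -(@eq_measure_integral _ _ _ setT nu (pushforward mu phi)).
    by rewrite integral_pushforward//; exact/measurable_EFinP.
  by move=> A mA _; exact: E.
have mfphi := cmeasurable_comp mf mphi.
have NE := ge0E _ (measurable_normc mf) (fun y => normc_ge0 (f y)).
have [mf1 mf2] := mf.
split=> H.
  have iN := hasc_integrable_normc H.
  have [_ N1 N2 N3] := H.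
  have iR := normc_integrable_Re mfphi iN.
  have iI := normc_integrable_Im mfphi iN.
  by split; rewrite ?NE// EE.
have [_ N1 N2 N3] := H.
have iN : mu.-integrable setT (fun x => (normc (f (phi x)))%:E).
  apply/integrableP; split; first exact/measurable_EFinP/measurable_normc.
  under eq_integral do rewrite gee0_abs ?lee_fin ?normc_ge0//.
  by rewrite -NE N1 ltry.
have iR := normc_integrable_Re mfphi iN.
have iI := normc_integrable_Im mfphi iN.
split => //; first by rewrite -NE.
- by rewrite -(EE (fun y => complex.Re (f y))).
- by rewrite -(EE (fun y => complex.Im (f y))).
Qed.

Section Fubini.
Context d1 d2 (T1 : measurableType d1) (T2 : measurableType d2) (R : realType).
Variables (m1 : {sigma_finite_measure set T1 -> \bar R}).
Variables (m2 : {sigma_finite_measure set T2 -> \bar R}).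
Local Notation m12 := (m1 \x m2)%E.

Lemma has_cintegral_swap (f : T1 * T2 -> R[i]) v w :
  has_cintegral m12 f v w ->
  has_cintegral (m2 \x m1)%E (fun x => f (x.2, x.1)) v w.
Proof.
move=> H.
apply/(@has_cintegral_pushforward _ _ _ _ R (fun x => (x.2, x.1)) _ m12) => //.
- exact: (@measurable_swap _ _ T2 T1).
- have mswap : measurable_fun setT (fun x : T2 * T1 => (x.2, x.1)).
    exact: (@measurable_swap _ _ T2 T1).
  move=> A mA; apply/esym.
  apply: (@product_measure_unique _ _ _ _ _ m1 m2
    (measure_function_pushforward__canonical__measure_function_Measure
       (m2 \x m1)%E mswap)) => //.
  move=> B C mB mC; rewrite /= /pushforward.
  rewrite [X in (m2 \x m1)%E X](_ : _ = C `*` B).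
    by rewrite product_measure1E// muleC.
  by apply/seteqP; split => -[x y] /= [].
- exact: hasc_measurable H.
Qed.

Let integral_normc_iterated (f : T1 * T2 -> R[i]) (g : T1 -> R[i]) c c' :
  cmeasurable f ->
  (forall x, has_cintegral m2 (fun y => f (x, y)) (c * g x) (c' * normc (g x))) ->
  (\int[m12]_z (normc (f z))%:E = \int[m1]_x (c' * normc (g x))%:E)%E.
Proof.
move=> mf H; rewrite fubini_tonelli1/=.
- by apply: eq_integral => x _; rewrite /fubini_F (hasc_normc (H x)).
- exact/measurable_EFinP/measurable_normc.
- by move=> z; rewrite lee_fin normc_ge0.
Qed.

(** Fubini's theorem in the form used throughout: the inner integrals of the
    function and of its modulus are the same multiples, [c] and [c'], of a
    function and of its modulus. *)
Lemma has_cintegral_fubini (f : T1 * T2 -> R[i]) (g : T1 -> R[i]) v w c c' :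
  cmeasurable f ->
  (forall x, has_cintegral m2 (fun y => f (x, y)) (c * g x) (c' * normc (g x))) ->
  has_cintegral m1 g v w -> has_cintegral m12 f (c * v) (c' * w).
Proof.
move=> mf H G; have iG := hasc_integrable_normc G.
have N : (\int[m12]_z (normc (f z))%:E = (c' * w)%:E)%E.
  rewrite (integral_normc_iterated mf H).
  under eq_integral do rewrite EFinM.
  by rewrite integralZl// (hasc_normc G).
have iN : m12.-integrable setT (fun z => (normc (f z))%:E).
  apply/integrableP; split; first exact/measurable_EFinP/measurable_normc.
  under eq_integral do rewrite gee0_abs ?lee_fin ?normc_ge0//.
  by rewrite N ltry.
have iR := normc_integrable_Re mf iN; have iI := normc_integrable_Im mf iN.
have cG := has_cintegralZ c G.
split => //.
- rewrite -integral12_prod_meas1//=.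
  under eq_integral do rewrite /fubini_F/= (hasc_Re (H _)).
  exact: hasc_Re cG.
- rewrite -integral12_prod_meas1//=.
  under eq_integral do rewrite /fubini_F/= (hasc_Im (H _)).
  exact: hasc_Im cG.
Qed.

(** The converse reading: the double integral is known, and the inner one
    identifies the integral of [g] when the constants can be divided out. *)
Lemma has_cintegral_fubiniV (f : T1 * T2 -> R[i]) (g : T1 -> R[i]) v w c c' :
  cmeasurable g -> c != 0 -> c' != 0 ->
  (forall x, has_cintegral m2 (fun y => f (x, y)) (c * g x) (c' * normc (g x))) ->
  has_cintegral m12 f v w -> has_cintegral m1 g (v / c) (w / c').
Proof.
move=> mg c0 c'0 H G; have iN := hasc_integrable_normc G.
have mf := hasc_measurable G.
have iR := normc_integrable_Re mf iN; have iI := normc_integrable_Im mf iN.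
suff cG : has_cintegral m1 (fun x => c * g x) v (normc c * (w / c')).
  have := has_cintegralZ c^-1 cG; rewrite mulrC normcV mulKf; last first.
    by apply: contra c0 => /eqP/eq0_normc->.
  by apply: has_cintegral_ext => x; rewrite mulKf.
have mcg : cmeasurable (fun x => c * g x).
  by apply: cmeasurableM => //; exact: cmeasurable_cst.
have c'g x : 0 <= c' * normc (g x).
  rewrite -lee_fin -(hasc_normc (H x)).
  by apply: integral_ge0 => y _; rewrite lee_fin normc_ge0.
split => //.
- have := integral_normc_iterated mf H; rewrite (hasc_normc G) => E.
  have mNg := measurable_normc mg.
  transitivity (\int[m1]_x ((normc c / c')%:E * (c' * normc (g x))%:E))%E.
    apply: eq_integral => x _; rewrite normcM -EFinM; congr EFin.
    by rewrite mulrA divfK.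
  rewrite integralZl//; first by rewrite -E -EFinM mulrAC mulrA.
  apply/integrableP; split; first exact/measurable_EFinP/measurable_funM.
  by under eq_integral do rewrite gee0_abs ?lee_fin//; rewrite -E ltry.
- rewrite -(hasc_Re G) -integral12_prod_meas1//=.
  by under [RHS]eq_integral do rewrite /fubini_F/= (hasc_Re (H _)).
- rewrite -(hasc_Im G) -integral12_prod_meas1//=.
  by under [RHS]eq_integral do rewrite /fubini_F/= (hasc_Im (H _)).
Qed.

End Fubini.

(** * Lebesgue measure in coordinates *)

Section LebesgueCoordinates.
Variable R : realType.
Local Notation mR := (measurableTypeR R).
Local Notation leb := (@lebesgue_measure R).

(** The coordinates [c y i] identify [nu] with Lebesgue measure on [R^I]; being
    stated on boxes, the property is insensitive to the way in which the
    coordinates are stored and ordered. *)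
Record is_lebesgue (I : finType) d (Y : measurableType d)
    (nu : {measure set Y -> \bar R}) (c : Y -> I -> mR) : Prop := IsLebesgue {
  is_lebesgue_measurable : forall i, measurable_fun setT (fun y => c y i) ;
  is_lebesgue_box : forall A : I -> set mR, (forall i, measurable (A i)) ->
    nu [set y | forall i, A i (c y i)] = (\prod_(i : I) leb (A i))%E }.

Lemma measurable_box (I : finType) d (Y : measurableType d)
    (c : Y -> I -> mR) (A : I -> set mR) :
  (forall i, measurable_fun setT (fun y => c y i)) ->
  (forall i, measurable (A i)) -> measurable [set y | forall i, A i (c y i)].
Proof.
move=> mc mA.
rewrite (_ : mkset _ = \bigcap_(i in setT) (fun y => c y i) @^-1` A i).
  apply: fin_bigcap_measurable => [|i _]; first exact: finite_finset.
  by rewrite -[X in measurable X]setTI; exact: mc.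
by apply/seteqP; split => y /= h i; [move=> _; exact: h|exact: h].
Qed.

Lemma lebesgue_tuple_is_lebesgue N :
  is_lebesgue (lebesgue_tuple R N) (fun x => tnth x).
Proof.
split=> [i|]; first exact: measurable_tnth.
elim: N => [|N IH] A mA.
  rewrite big_ord0 /= diracE mem_set//; by case.
rewrite big_ord_recl /= /lebesgue_tuple_cons /pushforward.
rewrite (_ : _ @^-1` _ = A ord0 `*`
    [set x : N.-tuple mR | forall i : 'I_N, A (lift ord0 i) (tnth x i)]); last first.
  apply/seteqP; split => -[a x] /=.
    move=> h; split; first exact: (h ord0).
    by move=> i; have := h (lift ord0 i); rewrite tnthS.
  move=> [h0 h] i; have [->|i0] := eqVneq i ord0; first exact: h0.
  have [j ->] : exists j, i = lift ord0 j.
    by case: (unliftP ord0 i) i0 => [j ->|->]; [exists j|rewrite eqxx].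
  by rewrite tnthS; exact: h.
rewrite product_measure1E//; first by rewrite (IH (fun i => A (lift ord0 i))).
apply: (@measurable_box _ _ _ (fun x => tnth x) (fun i => A (lift ord0 i))) => // i.
exact: measurable_tnth.
Qed.

(** Boxes generate the measurable sets and are stable under intersection. *)
Lemma is_lebesgue_tuple_unique N (nu : {measure set (N.-tuple mR) -> \bar R}) :
  is_lebesgue nu (fun x => tnth x) ->
  forall A, measurable A -> nu A = lebesgue_tuple R N A.
Proof.
move=> [_ nuE] A mA; apply/esym; move: A mA.
pose G : set (set (N.-tuple mR)) := [set X | exists2 A : 'I_N -> set mR,
  forall i, measurable (A i) & X = [set x | forall i, A i (tnth x i)]].
pose g k : set (N.-tuple mR) := [set x | forall i, (`[- k%:R, k%:R]%classic : set mR) (tnth x i)].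
have mg k : forall i : 'I_N, measurable (`[- k%:R, k%:R]%classic : set mR) by [].
have [_ lebE] := lebesgue_tuple_is_lebesgue N.
apply: (measure_unique G g).
- apply/seteqP; split.
    apply: smallest_sub; first exact: smallest_sigma_algebra.
    move=> X; rewrite -bigcup_seq => -[i _] [B mB <-]; apply: sub_sigma_algebra.
    exists (fun j => if j == i then B else setT).
      by move=> j; case: ifP.
    rewrite setTI; apply/seteqP; split => x /=.
      by move=> Bx j; case: eqP => [->|].
    by move=> /(_ i); rewrite eqxx.
  apply: smallest_sub; first exact: sigma_algebra_measurable.
  move=> _ [A mA ->]; apply: (@measurable_box _ _ _ (fun x => tnth x)) => // i.
  exact: measurable_tnth.
- move=> _ _ [A mA ->] [B mB ->]; exists (fun i => A i `&` B i).
    by move=> i; exact: measurableI.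
  by apply/seteqP; split => x /=; [move=> [h1 h2] i; split; [exact: h1|exact: h2]
    |move=> h; split=> i; have [] := h i].
- by move=> k; exists (fun=> `[- k%:R, k%:R]%classic).
- apply/seteqP; split => // x _.
  pose b := \sum_(i < N) `|tnth x i|.
  have b0 : 0 <= b by apply: sumr_ge0.
  exists (Num.truncn b).+1 => // i /=.
  rewrite in_itv/= -ler_norml.
  apply: le_trans (ltW (truncnS_gt b)).
  by rewrite /b (bigD1 i)//= lerDl sumr_ge0.
- move=> _ [A mA ->]; by rewrite lebE// nuE.
- move=> k; rewrite [g k]/g (lebE (fun=> `[- k%:R, k%:R]%classic))// ltey_eq prode_fin_num// => i _.
  by rewrite lebesgue_measure_itv/=; case: ifP => // _; rewrite -EFinB.
Qed.

(** The functions of [I]-indexed families of reals that are measurable in the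
    coordinates. *)
Definition coord_measurable (I : finType) (f : (I -> mR) -> R[i]) :=
  cmeasurable (fun x : #|I|.-tuple mR => f (fun i => tnth x (enum_rank i))).

Lemma coord_measurable_comp (I : finType) d (Y : measurableType d)
    (c : Y -> I -> mR) f :
  (forall i, measurable_fun setT (fun y => c y i)) ->
  coord_measurable f -> cmeasurable (fun y => f (c y)).
Proof.
move=> mc mf.
have mphi : measurable_fun setT
    (fun y => [tuple c y (enum_val k) | k < #|I|] : #|I|.-tuple mR).
  apply/measurable_fun_tnthP => k.
  by rewrite (_ : _ \o _ = fun y => c y (enum_val k))//; apply/funext => y /=;
    rewrite tnth_mktuple.
rewrite (_ : (fun y => _) = (fun y => f (fun i =>
    tnth [tuple c y (enum_val k) | k < #|I|] (enum_rank i)))).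
  exact: (cmeasurable_comp mf mphi).
apply/funext => y; congr f; apply/funext => i.
by rewrite tnth_mktuple enum_rankK.
Qed.

Let has_cintegral_tuple (I : finType) d (Y : measurableType d)
    (nu : {measure set Y -> \bar R}) (c : Y -> I -> mR) f v w :
  is_lebesgue nu c -> coord_measurable f ->
  has_cintegral nu (fun y => f (c y)) v w <->
  has_cintegral (lebesgue_tuple R #|I|)
    (fun x => f (fun i => tnth x (enum_rank i))) v w.
Proof.
move=> [mc cE] mf.
pose phi y : #|I|.-tuple mR := [tuple c y (enum_val k) | k < #|I|].
have mphi : measurable_fun setT phi.
  apply/measurable_fun_tnthP => k.
  by rewrite (_ : _ \o _ = fun y => c y (enum_val k))//; apply/funext => y /=;
    rewrite tnth_mktuple.
rewrite -(@has_cintegral_pushforward _ _ _ _ _ phi nu)//.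
  rewrite (_ : (fun y => f (c y)) = (fun y => f (fun i =>
    tnth (phi y) (enum_rank i))))//.
  apply/funext => y; congr f; apply/funext => i.
  by rewrite tnth_mktuple enum_rankK.
apply: (@is_lebesgue_tuple_unique _
  (measure_function_pushforward__canonical__measure_function_Measure nu mphi)).
split=> [i|A mA]; first exact: measurable_tnth.
rewrite /= /pushforward [X in nu X](_ : _ =
    [set y | forall i, A (enum_rank i) (c y i)]).
  by rewrite (cE (fun i => A (enum_rank i)))// (reindex_onto enum_rank enum_val)/=;
    [apply: eq_bigl => i; rewrite enum_rankK eqxx|move=> i _; rewrite enum_valK].
apply/seteqP; split => y /= h i.
  by have := h (enum_rank i); rewrite tnth_mktuple enum_rankK.
by rewrite tnth_mktuple; have := h (enum_val i); rewrite enum_valK.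
Qed.

(** An integral over [R^I] may be computed in any system of coordinates. *)
Lemma has_cintegral_coords (I : finType) d1 d2 (Y : measurableType d1)
    (Z : measurableType d2) (nu : {measure set Y -> \bar R})
    (mu : {measure set Z -> \bar R}) (c : Y -> I -> mR) (b : Z -> I -> mR) f v w :
  is_lebesgue nu c -> is_lebesgue mu b -> coord_measurable f ->
  has_cintegral nu (fun y => f (c y)) v w ->
  has_cintegral mu (fun z => f (b z)) v w.
Proof.
move=> cY bZ mf; move/(has_cintegral_tuple _ _ cY mf).
by move/(has_cintegral_tuple _ _ bZ mf).
Qed.

End LebesgueCoordinates.

(** * Complex powers *)

Section ComplexPowers.
Variable R : realType.
Implicit Types (a b z : R[i]) (x y : R).

Lemma cexpD a b : cexp (a + b) = cexp a * cexp b.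
Proof.
case: a b => [a1 a2] [b1 b2]; rewrite /cexp/= expRD cosD sinD.
by apply/eqP; rewrite eq_complex /=; apply/andP; split; apply/eqP; ring.
Qed.

Lemma cexp0 : cexp (0 : R[i]) = 1.
Proof. by rewrite /cexp/= expR0 cos0 sin0 mul1r. Qed.

Lemma normc_cexp z : normc (cexp z) = expR (complex.Re z).
Proof.
rewrite /cexp normcM normc_real ger0_norm ?expR_ge0// normcE2/=.
by rewrite cos2Dsin2 sqrtr1 mulr1.
Qed.

Lemma cexp_neq0 z : cexp z != 0.
Proof.
apply/eqP => z0; have := normc_cexp z; rewrite z0 normc0 => /esym/eqP.
by rewrite gt_eqF// expR_gt0.
Qed.

Lemma cexpN z : cexp (- z) = (cexp z)^-1.
Proof.
apply: (mulfI (cexp_neq0 z)); rewrite -cexpD subrr cexp0 divff//.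
exact: cexp_neq0.
Qed.

Lemma cexp_real x : cexp x%:C = (expR x)%:C.
Proof. by rewrite /cexp/= cos0 sin0 mulr1. Qed.

Lemma cmeasurable_cexp d (T : measurableType d) (f : T -> R[i]) :
  cmeasurable f -> cmeasurable (fun t => cexp (f t)).
Proof.
move=> [f1 f2]; apply: cmeasurableM.
  apply: cmeasurable_real; exact: measurableT_comp.
split => /=.
  apply: (@measurableT_comp _ _ _ _ _ _ (@cos R)) => //.
  by apply: continuous_measurable_fun; exact: continuous_cos.
apply: (@measurableT_comp _ _ _ _ _ _ (@sin R)) => //.
by apply: continuous_measurable_fun; exact: continuous_sin.
Qed.

Lemma cmeasurable_rpowc d (T : measurableType d) (f : T -> R) z :
  measurable_fun setT f -> cmeasurable (fun t => rpowc (f t) z).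
Proof.
move=> mf; apply: cmeasurable_cexp; apply: cmeasurableM.
  exact: cmeasurable_cst.
apply: cmeasurable_real.
by apply: (@measurableT_comp _ _ _ _ _ _ (@ln R)).
Qed.

Lemma rpowcD x a b : rpowc x (a + b) = rpowc x a * rpowc x b.
Proof. by rewrite /rpowc mulrDl cexpD. Qed.

Lemma rpowcN x a : rpowc x (- a) = (rpowc x a)^-1.
Proof. by rewrite /rpowc mulNr cexpN. Qed.

Lemma rpowcB x a b : rpowc x (a - b) = rpowc x a / rpowc x b.
Proof. by rewrite rpowcD rpowcN. Qed.

Lemma rpowc0 x : rpowc x 0 = 1.
Proof. by rewrite /rpowc mul0r cexp0. Qed.

Lemma rpow1c a : rpowc 1 a = 1.
Proof. by rewrite /rpowc ln1 mulr0 cexp0. Qed.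

Lemma rpowc_neq0 x a : rpowc x a != 0.
Proof. exact: cexp_neq0. Qed.

Lemma rpowcM x y a : 0 < x -> 0 < y -> rpowc (x * y) a = rpowc x a * rpowc y a.
Proof.
by move=> x0 y0; rewrite /rpowc lnM ?posrE// rmorphD mulrDr cexpD.
Qed.

Lemma rpowc_real x y : rpowc x y%:C = (expR (y * ln x))%:C.
Proof. by rewrite /rpowc -rmorphM cexp_real. Qed.

Lemma rpowc1 x : 0 < x -> rpowc x 1 = x%:C.
Proof. by move=> x0; rewrite (rpowc_real x 1) mul1r lnK. Qed.

Lemma rpowc_nat x n : 0 < x -> rpowc x n%:R = (x ^+ n)%:C.
Proof.
move=> x0; elim: n => [|n IH]; first by rewrite rpowc0 expr0.
by rewrite -natr1 rpowcD IH rpowc1// -rmorphM exprSr.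
Qed.

Lemma normc_rpowc x a : normc (rpowc x a) = expR (complex.Re a * ln x).
Proof. by rewrite /rpowc normc_cexp ReM/= mulr0 subr0. Qed.

Lemma normc_rpowc_real x a : (normc (rpowc x a))%:C = rpowc x (complex.Re a)%:C.
Proof. by rewrite normc_rpowc rpowc_real. Qed.

Lemma rpowc_sqrt x : 0 < x -> rpowc x (2^-1) = (Num.sqrt x)%:C.
Proof.
move=> x0; rewrite (_ : 2^-1 = (2^-1 : R)%:C); last by rewrite fmorphV rmorph_nat.
rewrite rpowc_real; congr (_%:C).
apply/eqP; rewrite -(@eqrXn2 _ 2)// ?expR_ge0 ?sqrtr_ge0//.
rewrite sqr_sqrtr ?ltW// -expRM_natl mulrA mulfV ?mul1r ?lnK//.
Qed.

Lemma rpowcE x a : rpowc x a =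
  (expR (complex.Re a * ln x) * cos (complex.Im a * ln x)) +i*
  (expR (complex.Re a * ln x) * sin (complex.Im a * ln x)).
Proof.
rewrite /rpowc /cexp; case: a => a b /=.
apply/eqP; rewrite eq_complex/=; apply/andP; split; apply/eqP;
by rewrite !mulr0 ?subr0 ?add0r ?addr0 ?mul0r ?subr0 ?addr0.
Qed.

Lemma is_derive_rpowc (k z : R[i]) (s : R) : 0 < s ->
  is_derive s 1 (fun s : R => complex.Re (k * rpowc s z))
    (complex.Re (k * z * rpowc s (z - 1))).
Proof.
move=> s0; under eq_fun do rewrite rpowcE ReM/=.
have dl := is_derive1_ln s0.
set a := complex.Re z; set b := complex.Im z.
apply: is_derive_eq.
rewrite rpowcB rpowc1// rpowcE -/a -/b -fmorphV.
case: k => k1 k2; rewrite (_ : z = a +i* b); last by rewrite /a /b; case: (z).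
rewrite /= /GRing.scale/=; set E := expR _; set C := cos _; set S := sin _.
ring.
Qed.

End ComplexPowers.

(** * Affine changes of variable on the line *)

Section OneVariable.
Variable R : realType.
Local Notation mR := (measurableTypeR R).
Local Notation leb := (@lebesgue_measure R).

Lemma has_cintegral_on d (T : measurableType d) (mu : {measure set T -> \bar R})
    (D : set T) (f : T -> R[i]) v w : measurable D -> cmeasurable f ->
  (\int[mu]_(x in D) (normc (f x))%:E = w%:E)%E ->
  (\int[mu]_(x in D) (complex.Re (f x))%:E = (complex.Re v)%:E)%E ->
  (\int[mu]_(x in D) (complex.Im (f x))%:E = (complex.Im v)%:E)%E ->
  has_cintegral mu (fun x => (\1_D x)%:C * f x) v w.
Proof.
move=> mD mf N1 N2 N3.
have E (g : T -> R) x : ((fun x => (g x)%:E) \_ D) x = (\1_D x * g x)%:E.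
  by rewrite patchE indicE; case: ifPn; rewrite ?mul1r ?mul0r.
split.
- by apply: cmeasurableM => //; apply: cmeasurable_real; exact: measurable_indic.
- rewrite -N1 [RHS]integral_mkcond; apply: eq_integral => x _.
  by rewrite E normcM normc_real ger0_norm// indicE.
- rewrite -N2 [RHS]integral_mkcond; apply: eq_integral => x _.
  by rewrite E ReM/= mul0r subr0.
- rewrite -N3 [RHS]integral_mkcond; apply: eq_integral => x _.
  by rewrite E ImM/= mul0r addr0.
Qed.

Lemma has_cintegral_shift (f : mR -> R[i]) (c : R) v w :
  has_cintegral leb f v w -> has_cintegral leb (fun x => f (x - c)) v w.
Proof.
move=> H.
have ms : measurable_fun setT (fun x : mR => x - c : mR).
  by apply: measurable_funB.
apply/(@has_cintegral_pushforward _ _ _ _ R (fun x : mR => x - c : mR) leb leb) => //.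
  move=> A mA; apply/esym.
  apply: (@lebesgue_measure_unique R
    (measure_function_pushforward__canonical__measure_function_Measure leb ms)) => //.
  move=> _ [[a b] _ <-]; rewrite /= /pushforward.
  rewrite (_ : _ @^-1` _ = `]a + c, b + c]%classic).
    rewrite !lebesgue_measure_itv/= !lte_fin ltrD2r.
    by case: ifP => // _; rewrite -!EFinB; congr EFin; ring.
  by apply/seteqP; split => x /=; rewrite !in_itv/= ltrBrDr lerBlDr.
exact: hasc_measurable H.
Qed.

Lemma has_cintegral_mscale d (T : measurableType d) (mu : {measure set T -> \bar R})
    (f : T -> R[i]) (k : {nonneg R}) v w : has_cintegral mu f v w ->
  has_cintegral (mscale k mu) f (k%:num%:C * v) (k%:num * w).
Proof.
move=> H; have iN := hasc_integrable_normc H.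
have [mf N1 N2 N3] := H.
have iR := normc_integrable_Re mf iN; have iI := normc_integrable_Im mf iN.
have E (g : T -> \bar R) : mu.-integrable setT g ->
    (\int[mscale k mu]_x g x = (k%:num)%:E * \int[mu]_x g x)%E.
  move=> ig; rewrite [LHS]integralE [X in (_ * X)%E]integralE.
  have mg := measurable_int _ ig.
  rewrite !ge0_integral_mscale//; [|exact: measurable_funeneg|exact: measurable_funepos].
  have /fineK <- : (\int[mu]_x g^\+ x)%E \is a fin_num.
    by apply: integrable_fin_num => //; exact: integrable_funepos.
  have /fineK <- : (\int[mu]_x g^\- x)%E \is a fin_num.
    by apply: integrable_fin_num => //; exact: integrable_funeneg.
  by rewrite -EFinB -!EFinM mulrBr.
split => //.
- by rewrite E// N1.
- by rewrite E// N2 ReM/= mul0r subr0.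
- by rewrite E// N3 ImM/= mul0r addr0.
Qed.

Lemma has_cintegral_scale (f : mR -> R[i]) (c : R) v w : 0 < c ->
  has_cintegral leb f v w ->
  has_cintegral leb (fun x => f (c * x)) (c^-1%:C * v) (c^-1 * w).
Proof.
move=> c0 H.
have ms : measurable_fun setT (fun x : mR => c * x : mR).
  by apply: measurable_funM.
have ci : 0 <= c^-1 by rewrite invr_ge0 ltW.
pose k : {nonneg R} := NngNum ci.
apply/(@has_cintegral_pushforward _ _ _ _ R (fun x : mR => c * x : mR) leb (mscale k leb)) => //.
- move=> A mA.
  have c0' : 0 <= c by exact: ltW.
  pose k' : {nonneg R} := NngNum c0'.
  have L : leb A = mscale k'
      (measure_function_pushforward__canonical__measure_function_Measure leb ms) A.
    apply: lebesgue_measure_unique mA => _ [[a b] _ <-].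
    rewrite [RHS](_ : _ = (c%:E * leb ((fun x : mR => (c * x)%R : mR) @^-1` `]a, b]))%E)//.
    rewrite (_ : _ @^-1` _ = `]c^-1 * a, c^-1 * b]%classic).
      rewrite !lebesgue_measure_itv/= !lte_fin ltr_pM2l ?invr_gt0//.
      case: ifP => _; last by rewrite mule0.
      rewrite -!EFinB -EFinM; congr EFin; rewrite -mulrBr mulrA divff ?mul1r//.
      by rewrite gt_eqF.
    apply/seteqP; split => x /=; rewrite !in_itv/=;
    by rewrite ltr_pdivrMl// ler_pdivlMl.
  rewrite [RHS](_ : _ = (c^-1%:E * leb A)%E)// L.
  rewrite [X in (_ * X)%E](_ : _ = (c%:E * leb ((fun x : mR => (c * x)%R : mR) @^-1` A))%E)//.
  by rewrite muleA -EFinM mulVf ?gt_eqF// mul1e.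
- exact: hasc_measurable H.
- exact: has_cintegral_mscale.
Qed.

End OneVariable.

(** * The Gamma integral *)

Section PowerTail.
Variable R : realType.
Local Notation mR := (measurableTypeR R).
Local Notation leb := (@lebesgue_measure R).
Implicit Types (z : R[i]) (x : R).

Lemma cvg_rpow0 x : 0 < x -> (expR (- x * ln s) @[s --> +oo%R] --> (0 : R)).
Proof.
move=> x0; apply/cvgr0Pnorm_lt => e e0.
near=> s.
have s0 : 0 < s by near: s; exact: nbhs_pinfty_gt.
rewrite ger0_norm ?expR_ge0// -[ltRHS]lnK// ltr_expR.
rewrite mulNr ltrNl -ltr_pdivrMl// -ltr_expR lnK//.
Unshelve. all: by end_near. Qed.

(** The multiple [a] of the modulus makes the integrand nonnegative, so that
    the fundamental theorem of calculus on the half-line applies. *)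
Lemma integral_rpowc_tail z (k : R[i]) (a : R) : 0 < complex.Re z ->
  normc k <= a ->
  (\int[leb]_(s in `[1%R, +oo[) (a * normc (rpowc s (- z - 1)) +
      complex.Re (k * rpowc s (- z - 1)))%:E =
    (a / complex.Re z + complex.Re (k / z))%:E)%E.
Proof.
move=> z0 ka; set x := complex.Re z.
have a0 : 0 <= a by rewrite (le_trans _ ka)// normc_ge0.
have zn0 : z != 0 by apply: contraTneq z0 => ->; rewrite ltxx.
have xn0 : x%:C != 0 by rewrite eq_complex/= gt_eqF.
pose F s := complex.Re (- (a%:C / x%:C) * rpowc s (- x%:C)) +
  complex.Re (- (k / z) * rpowc s (- z)).
pose f s := complex.Re (a%:C * rpowc s (- x%:C - 1)) +
  complex.Re (k * rpowc s (- z - 1)).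
have fE (s : R) : 0 < s -> a * normc (rpowc s (- z - 1)) +
      complex.Re (k * rpowc s (- z - 1)) = f s.
  move=> s0; rewrite /f; congr (_ + _).
  rewrite (_ : - x%:C - 1 = (complex.Re (- z - 1))%:C); last first.
    by rewrite /x; case: (z) => ? ? /=; rewrite rmorphB rmorphN.
  by rewrite -normc_rpowc_real -rmorphM.
have dF (s : R) : 0 < s -> is_derive s 1 F (f s).
  move=> s0; apply: is_deriveD.
    have := is_derive_rpowc (- (a%:C / x%:C)) (- x%:C) s0.
    by rewrite mulrNN divfK.
  have := is_derive_rpowc (- (k / z)) (- z) s0.
  by rewrite mulrNN divfK.
have df (s : R) : 0 < s -> is_derive s 1 f
    (complex.Re (a%:C * (- x%:C - 1) * rpowc s (- x%:C - 1 - 1)) +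
     complex.Re (k * (- z - 1) * rpowc s (- z - 1 - 1))).
  by move=> s0; apply: is_deriveD; exact: is_derive_rpowc.
have F1 : F 1 = - (a / x + complex.Re (k / z)).
  rewrite /F !rpow1c !mulr1 opprD; congr (_ + _).
    by rewrite -fmorphV -rmorphM.
  by case: (k / z).
rewrite (_ : (_ + _)%:E = 0%:E - (F 1)%:E)%E; last first.
  by rewrite -EFinB F1 opprK add0r.
under eq_integral => s.
  rewrite inE/= in_itv/= andbT => s1.
  rewrite fE; last by rewrite (lt_le_trans _ s1).
  over.
apply: (ge0_continuous_FTC2y (F := F)).
- move=> s s1; rewrite -fE; last by rewrite (lt_le_trans _ s1).
  rewrite -lerBlDl sub0r.
  have := Re_le_normc (k * rpowc s (- z - 1)); rewrite ler_norml => /andP[+ _].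
  by apply: le_trans; rewrite lerN2 normcM ler_wpM2r// normc_ge0.
- apply: derivable_within_continuous => s; rewrite in_itv/= andbT => s1.
  exact: (@ex_derive _ _ _ _ _ _ _ (df _ (lt_le_trans ltr01 s1))).
- have cF w c : 0 < complex.Re w ->
      complex.Re (c * rpowc s (- w)) @[s --> +oo] --> (0 : R).
    move=> w0.
    have L : normc c * expR (- complex.Re w * ln s) @[s --> +oo] --> (0 : R).
      by rewrite -(mulr0 (normc c)); apply: cvgM; [exact: cvg_cst|exact: cvg_rpow0].
    apply: (squeeze_cvgr (f :=
      fun s => - (normc c * expR (- complex.Re w * ln s))) _ _ L).
      apply: nearW => s; rewrite -ler_norml; apply: le_trans (Re_le_normc _) _.
      by rewrite normcM normc_rpowc; case: (w).
    by rewrite -oppr0; apply: cvgN.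
  by rewrite -[0]addr0; apply: cvgD; apply: cF.
- by move=> s s1; exact: (@ex_derive _ _ _ _ _ _ _ (dF _ (lt_trans ltr01 s1))).
- apply: cvg_at_right_filter.
  have /derivable1_diffP/differentiable_continuous := @ex_derive _ _ _ _ _ _ _ (dF 1 ltr01).
  exact.
- move=> s; rewrite in_itv/= andbT => s1.
  by rewrite derive1E; exact: (@derive_val _ _ _ _ _ _ _ (dF _ (lt_trans ltr01 s1))).
Qed.

End PowerTail.

Section GammaIntegral.
Variable R : realType.
Local Notation mR := (measurableTypeR R).
Local Notation leb := (@lebesgue_measure R).
Implicit Types (z : R[i]) (x : R).

Lemma measurable_expRN d (T : measurableType d) (f : T -> R) :
  measurable_fun setT f -> measurable_fun setT (fun t => expR (- f t)).
Proof.
move=> mf; apply: measurableT_comp => //.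
exact: measurable_funN.
Qed.

Lemma has_cintegral_rpowc_tail z : 0 < complex.Re z ->
  has_cintegral leb (fun s : mR => (\1_`[1, +oo[ s)%:C * rpowc s (- z - 1))
    z^-1 (complex.Re z)^-1.
Proof.
move=> z0.
have mr : cmeasurable (fun s : mR => rpowc s (- z - 1)).
  by apply: cmeasurable_rpowc.
have [mr1 mr2] := mr; have mN := measurable_normc mr.
have N1 : (\int[leb]_(s in `[1%R, +oo[) (normc (rpowc s (- z - 1)))%:E
    = (complex.Re z)^-1%:E)%E.
  have := @integral_rpowc_tail R z 0 1 z0; rewrite normc0 ler01 => /(_ erefl).
  rewrite !mul0r addr0 div1r => <-; apply: eq_integral => s _.
  by rewrite mul0r mul1r addr0.
have iN : leb.-integrable `[1, +oo[ (fun s => (normc (rpowc s (- z - 1)))%:E).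
  apply/integrableP; split; first exact/measurable_EFinP/measurable_funTS.
  under eq_integral do rewrite gee0_abs ?lee_fin ?normc_ge0//.
  by rewrite N1 ltry.
have part (k : R[i]) : normc k <= 1 ->
    (\int[leb]_(s in `[1%R, +oo[) (complex.Re (k * rpowc s (- z - 1)))%:E
    = (complex.Re (k / z))%:E)%E.
  move=> k1; have := integral_rpowc_tail z0 k1.
  have mkr : cmeasurable (fun s : mR => k * rpowc s (- z - 1)).
    by apply: cmeasurableM => //; exact: cmeasurable_cst.
  under eq_integral do rewrite mul1r EFinD.
  rewrite integralD//; last first.
    apply: le_integrable iN => //.
      by apply/measurable_EFinP/measurable_funTS; case: mkr.
    move=> s _; rewrite !abse_EFin lee_fin (ger0_norm (normc_ge0 _)).
    by rewrite (le_trans (Re_le_normc _))// normcM ler_piMl// normc_ge0.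
  have cancel (a b : R) I : (a%:E + I = (a + b)%:E -> I = b%:E)%E.
    by case: I => //= r [] /addrI ->.
  by rewrite N1 div1r => /cancel.
have ReMi (a : R[i]) : complex.Re (- 'i%C * a) = complex.Im a.
  by case: a => a b /=; rewrite oppr0 mul0r sub0r mulN1r opprK.
apply: has_cintegral_on => //.
- by rewrite -[z^-1]mul1r -part ?normc1//; apply: eq_integral => s _; rewrite mul1r.
- rewrite -ReMi -part//; first by apply: eq_integral => s _; rewrite ReMi.
  by rewrite normcE2/= oppr0 expr0n/= add0r sqrrN expr1n sqrtr1.
Qed.

Lemma has_cintegral_exp_tail (t : R) : 0 < t ->
  has_cintegral leb (fun s : mR => (\1_`[1, +oo[ s)%:C * (expR (- (t * s)))%:C)
    (expR (- t) / t)%:C (expR (- t) / t).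
Proof.
move=> t0.
have tn0 : t != 0 by rewrite gt_eqF.
have E : (\int[leb]_(s in `[1%R, +oo[) (expR (- (t * s)))%:E
    = (expR (- t) / t)%:E)%E.
  have dF (s : R) : is_derive s 1 (fun s : R => - t^-1 * expR (- (t * s)))
      (expR (- (t * s))).
    apply: is_derive_eq; rewrite /= /GRing.scale/= !mulr1.
    by field.
  rewrite (@ge0_continuous_FTC2y R _ (fun s : R => - t^-1 * expR (- (t * s))) 1 0).
  - by rewrite mulr1 sub0e mulNr -EFinN opprK mulrC.
  - by move=> s _; exact: expR_ge0.
  - have dE (s : R) : is_derive s 1 (fun s : R => expR (- (t * s)))
        (expR (- (t * s)) * - t).
      by apply: is_derive_eq; rewrite /= /GRing.scale/= !mulr1.
    apply: derivable_within_continuous => s _.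
    exact: (@ex_derive _ _ _ _ _ _ _ (dE s)).
  - rewrite -(mulr0 (- t^-1)); apply: cvgM; first exact: cvg_cst.
    apply: (@cvg_comp _ _ _ (fun s => t * s) (fun s => expR (- s)) _ (pinfty_nbhs R)).
      exact: gt0_cvgMry.
    exact: cvgr_expR.
  - by move=> s _; exact: (@ex_derive _ _ _ _ _ _ _ (dF s)).
  - apply: cvg_at_right_filter.
    have /derivable1_diffP/differentiable_continuous := @ex_derive _ _ _ _ _ _ _ (dF 1).
    exact.
  - by move=> s _; rewrite derive1E; exact: (@derive_val _ _ _ _ _ _ _ (dF s)).
apply: has_cintegral_on => //.
- apply: cmeasurable_real; apply: measurable_expRN; exact: measurable_funM.
- by rewrite -E; apply: eq_integral => s _; rewrite normc_real ger0_norm ?expR_ge0.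
- exact: integral0.
Qed.

Definition gamma_fun z (t : mR) : R[i] :=
  (\1_`]0, +oo[ t)%:C * (rpowc t (z - 1) * (expR (- t))%:C).

Lemma cmeasurable_indic d (T : measurableType d) (A : set T) :
  measurable A -> cmeasurable (fun t => (\1_A t : R)%:C).
Proof. by move=> mA; apply: cmeasurable_real; exact: measurable_indic. Qed.

Lemma cmeasurable_gamma_fun z : cmeasurable (gamma_fun z).
Proof.
apply: cmeasurableM; first exact: cmeasurable_indic.
apply: cmeasurableM; first exact: cmeasurable_rpowc.
by apply: cmeasurable_real; apply: measurable_expRN.
Qed.

Lemma gamma_fun_cGamma z v w : has_cintegral leb (gamma_fun z) v w -> v = cGamma z.
Proof. by move=> /has_cintegral_restrict[]// _ <-. Qed.

Lemma indicC T (A : set T) (t : T) :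
  (\1_A t)%:C = (if t \in A then 1 else 0) :> R[i].
Proof. by rewrite indicE; case: ifP. Qed.

Lemma indicC_pos (t : R) : (\1_`]0, +oo[ t)%:C = (if 0 < t then 1 else 0) :> R[i].
Proof.
rewrite indicC (_ : (t \in _) = (0 < t))//.
by apply/idP/idP; rewrite inE/= in_itv/= andbT.
Qed.

Lemma has_cintegral_gamma_scale z v w (c : R) : 0 < c ->
  has_cintegral leb (gamma_fun z) v w ->
  has_cintegral leb (fun t : mR =>
      (\1_`]0, +oo[ t)%:C * (rpowc t (z - 1) * (expR (- (c * t)))%:C))
    (v * rpowc c (- z)) (w * normc (rpowc c (- z))).
Proof.
move=> c0 /(has_cintegral_scale c0)/(has_cintegralZ (rpowc c (z - 1))^-1).
rewrite (_ : (rpowc c (z - 1))^-1 * _ = v * rpowc c (- z)); last first.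
  rewrite -rpowcN opprB addrC rpowcD rpowc1//.
  by rewrite [RHS]mulrC -mulrA; congr (_ * _); rewrite mulrA -rmorphM divff ?mul1r// gt_eqF.
rewrite (_ : normc (rpowc c (z - 1))^-1 * _ = w * normc (rpowc c (- z))); last first.
  rewrite -rpowcN opprB addrC rpowcD rpowc1// normcM normc_real gtr0_norm//.
  by rewrite [RHS]mulrC -mulrA; congr (_ * _); rewrite mulrA divff ?mul1r// gt_eqF.
apply: has_cintegral_ext => t; rewrite /gamma_fun !indicC_pos pmulr_rgt0//.
have [t0|_] := ltP 0 t; last by rewrite !mul0r mulr0.
rewrite rpowcM// !mul1r; move: (rpowc_neq0 c (z - 1)).
by move: (rpowc c _) (rpowc t _) => a b a0; rewrite -mulrA mulKf.
Qed.

(** Integrate [t ^ z e^{-ts}] over [t > 0] and [s >= 1] in both orders; this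
    both proves the functional equation and extends the convergence of the
    integral from [z + 1] to [z]. *)
Lemma has_cintegral_gammaS z v w : 0 < complex.Re z ->
  has_cintegral leb (gamma_fun (z + 1)) v w ->
  has_cintegral leb (gamma_fun z) (v / z) (w / complex.Re z).
Proof.
move=> z0 H.
pose K (p : mR * mR) : R[i] := (\1_`[1, +oo[ p.1)%:C *
  ((\1_`]0, +oo[ p.2)%:C * (rpowc p.2 (z + 1 - 1) * (expR (- (p.1 * p.2)))%:C)).
have mK : cmeasurable K.
  apply: cmeasurableM.
    by apply: (cmeasurable_comp (f := fun t : mR => (\1_`[1, +oo[ t)%:C));
      first exact: cmeasurable_indic.
  apply: cmeasurableM.
    by apply: (cmeasurable_comp (f := fun t : mR => (\1_`]0, +oo[ t)%:C));
      first exact: cmeasurable_indic.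
  apply: cmeasurableM; first exact: cmeasurable_rpowc.
  by apply: cmeasurable_real; apply: measurable_expRN; exact: measurable_funM.
have HK : has_cintegral (leb \x leb)%E K (v * z^-1) (w * (complex.Re z)^-1).
  apply: has_cintegral_fubini (has_cintegral_rpowc_tail z0) => // s.
  rewrite /K/= indicC; case: ifPn => [|_]; last first.
    rewrite !mul0r normc0 !mulr0.
    by apply: has_cintegral0 => t; rewrite mul0r.
  rewrite inE/= in_itv/= andbT => s1; have s0 := lt_le_trans ltr01 s1.
  have := has_cintegral_gamma_scale s0 H; rewrite opprD mul1r.
  by apply: has_cintegral_ext => t; rewrite mul1r.
rewrite -[v / z]divr1 -[w / _]divr1.
apply: has_cintegral_fubiniV (has_cintegral_swap HK);
  [exact: cmeasurable_gamma_fun|exact: oner_neq0|exact: oner_neq0|].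
move=> t; rewrite /K/= /gamma_fun.
have [t0|t0] := ltP 0 t; last first.
  rewrite indicC_pos ltNge t0 !mul0r mulr0 normc0 mulr0.
  by apply: has_cintegral0 => s; rewrite mul0r mulr0.
have := has_cintegralZ (rpowc t z) (has_cintegral_exp_tail t0).
rewrite indicC_pos t0 !mul1r addrK.
rewrite (_ : rpowc t z * _ = rpowc t (z - 1) * (expR (- t))%:C); last first.
  rewrite rpowcB rpowc1// rmorphM fmorphV; move: (rpowc t z) => a.
  by rewrite -[RHS]mulrA [in RHS](mulrC _^-1).
rewrite (_ : normc (rpowc t z) * _ = normc (rpowc t (z - 1) * (expR (- t))%:C)); last first.
  rewrite rpowcB rpowc1// !normcM normcV !normc_real !ger0_norm ?expR_ge0//; last exact: ltW.
  by rewrite -[RHS]mulrA [in RHS](mulrC _^-1).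
apply: has_cintegral_ext => s; rewrite [s * t]mulrC.
by rewrite mul1r [LHS]mulrCA.
Qed.

(** The integrand is dominated by a multiple of [e^{-t/2}]. *)
Lemma has_cintegral_gamma_ge1 z : 1 <= complex.Re z -> exists v w,
  has_cintegral leb (gamma_fun z) v w.
Proof.
move=> z1; set a := complex.Re z - 1; have a0 : 0 <= a by rewrite subr_ge0.
have h0 : 0 < (2^-1 : R) by rewrite invr_gt0.
have := hasc_integrable_normc (has_cintegral_shift (- 1) (has_cintegral_exp_tail h0)).
set g := fun x : mR => _.
(* [ln (t / d) < t / d] costs [a t / d], which is at most [t / 2] for this [d]. *)
pose d := (a + 1) *+ 2; have d0 : 0 < d by rewrite pmulrn_lgt0// ltr_wpDl.
pose C := expR (a * ln d + 2^-1).
move=> /(integrableZl measurableT C) ig.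
have {}ig : leb.-integrable setT (fun t => (normc (gamma_fun z t))%:E).
  apply: le_integrable ig => //.
    exact/measurable_EFinP/measurable_normc/cmeasurable_gamma_fun.
  move=> t _; rewrite -EFinM !abse_EFin lee_fin [leRHS]ger0_norm; last first.
    by rewrite mulr_ge0 ?expR_ge0// normc_ge0.
  rewrite (ger0_norm (normc_ge0 _)) /g /gamma_fun indicC_pos.
  have [t0|_] := ltP 0 t; last by rewrite mul0r normc0 mulr_ge0 ?expR_ge0// normc_ge0.
  rewrite mul1r normcM normc_rpowc [complex.Re _](_ : _ = a); last first.
    by rewrite /a; case: (z).
  rewrite opprK indicC mem_set/=; last by rewrite in_itv/= andbT lerDr ltW.
  rewrite mul1r !normc_real !(ger0_norm (expR_ge0 _)) /C -!expRD ler_expR.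
  have := ln_sublinear (divr_gt0 t0 d0); rewrite ln_div// ltrBlDr => /ltW.
  move=> /(ler_wpM2l a0); rewrite mulrDr => H.
  have K : a * (t / d) <= t / 2.
    rewrite mulrA ler_pdivrMr// [leRHS](_ : _ = (a + 1) * t); last first.
      by rewrite /d -mulr_natr; field.
    by rewrite ler_wpM2r ?ltW// ltrDl.
  have : a * ln t <= t / 2 + a * ln d by rewrite (le_trans H)// lerD2r.
  lra.
have mg := cmeasurable_gamma_fun z.
have iR := normc_integrable_Re mg ig; have iI := normc_integrable_Im mg ig.
exists (cintegral leb setT (gamma_fun z)).
exists (fine (\int[leb]_t (normc (gamma_fun z t))%:E)%E).
by split => //=; rewrite /Rintegral fineK//; exact: integrable_fin_num.
Qed.

Lemma has_cintegral_gamma_ex z : 0 < complex.Re z -> exists v w,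
  has_cintegral leb (gamma_fun z) v w.
Proof.
move=> z0; have [|v [w H]] := @has_cintegral_gamma_ge1 (z + 1).
  by rewrite raddfD/= lerDr ltW.
by exists (v / z), (w / complex.Re z); exact: has_cintegral_gammaS.
Qed.

(** The integral of the modulus of Euler's integrand at any [z] of real part
    [x]; this is Gamma at [x], as a real number. *)
Definition absGamma x : R := fine (\int[leb]_t (normc (gamma_fun x%:C t))%:E)%E.

Lemma has_cintegral_gamma z : 0 < complex.Re z ->
  has_cintegral leb (gamma_fun z) (cGamma z) (absGamma (complex.Re z)).
Proof.
move=> z0; have [v [w H]] := has_cintegral_gamma_ex z0.
rewrite -(gamma_fun_cGamma H) /absGamma.
rewrite (_ : (\int[leb]_t _)%E = w%:E)%E//.
rewrite -(hasc_normc H); apply: eq_integral => t _.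
rewrite /gamma_fun normcM [in RHS]normcM; congr (_ * _)%:E.
rewrite normcM [in RHS]normcM; congr (_ * _).
by rewrite !normc_rpowc; case: (z).
Qed.

Lemma cGammaS z : 0 < complex.Re z -> cGamma (z + 1) = z * cGamma z.
Proof.
move=> z0; have zn0 : z != 0 by apply: contraTneq z0 => ->; rewrite ltxx.
have z10 : 0 < complex.Re (z + 1) by rewrite raddfD/= addr_gt0.
rewrite -(gamma_fun_cGamma (has_cintegral_gammaS z0 (has_cintegral_gamma z10))).
by rewrite mulrC divfK.
Qed.

Lemma absGammaS x : 0 < x -> absGamma (x + 1) = x * absGamma x.
Proof.
move=> x0.
have x10 : 0 < complex.Re (x%:C + 1) by rewrite /= addr_gt0.
have x0' : 0 < complex.Re x%:C by [].
have := hasc_normc (has_cintegral_gammaS x0' (has_cintegral_gamma x10)).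
rewrite (hasc_normc (has_cintegral_gamma x0')) => -[] /= ->.
by rewrite mulrC divfK// gt_eqF.
Qed.

End GammaIntegral.

(** * Nonvanishing of Gamma on the right half-plane *)

Section GammaNonzero.
Variable R : realType.
Local Notation mR := (measurableTypeR R).
Local Notation leb := (@lebesgue_measure R).
Implicit Types (z : R[i]) (x y : R).

Lemma cos_lower y : 1 - y ^+ 2 / 2 <= cos y.
Proof.
have sin_le u : 0 <= u -> `|sin u| <= u :> R.
  move=> u0.
  have cs : {within `[0, u], continuous (@sin R)}.
    by apply: continuous_subspaceT; exact: continuous_sin.
  have [c _] := MVT_segment u0 (fun t _ => is_derive_sin t) cs.
  rewrite sin0 !subr0 => ->; rewrite normrM (ger0_norm u0).
  by rewrite ler_piMl// cos_max.
have sin2_le u : sin u ^+ 2 <= u ^+ 2 :> R.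
  rewrite -[leRHS]real_normK ?num_real// -[leLHS]real_normK ?num_real//.
  rewrite ler_sqr ?nnegrE//; have [u0|u0] := leP 0 u.
    by rewrite (le_trans (sin_le _ u0))// ler_norm.
  by rewrite -[sin u]opprK -sinN normrN (ltr0_norm u0) sin_le// oppr_ge0 ltW.
rewrite -[in leRHS](divfK (_ : 2 != 0 :> R) y)// mulr_natr cos_mulr2n.
rewrite cos2sin2.
by have := sin2_le (y / 2); lra.
Qed.

(** With [v = ln s], this is [v <= 2 (e^{v/2} - e^{-v/2})]. The right-hand side is
    chosen so that, for [s = t / x], it turns the Gamma density at [x] into those
    at [x - 1], [x] and [x + 1]. *)
Lemma sqr_ln_le (s : R) : 0 < s -> ln s ^+ 2 <= 4 * (s - 2 + s^-1).
Proof.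
suff H v : 0 <= v -> v ^+ 2 <= 4 * (expR v - 2 + expR (- v)) :> R.
  move=> s0; have [ls|ls] := leP 0 (ln s).
    by have := H _ ls; rewrite expRN lnK.
  rewrite -sqrrN; have := H (- ln s); rewrite opprK expRN lnK// oppr_ge0 ltW//.
  by move=> /(_ erefl); lra.
move=> v0; pose p := expR (v / 2); pose q := expR (- (v / 2)).
have pq : p * q = 1 by rewrite /p /q expRN divff// gt_eqF// expR_gt0.
have -> : expR v = p ^+ 2.
  by rewrite /p expr2 -expRD; congr expR; lra.
have -> : expR (- v) = q ^+ 2.
  by rewrite /q expr2 -expRD; congr expR; lra.
have p1 : 1 + v / 2 <= p by exact: expR_ge1Dx.
have q1 : q <= 1 by rewrite /q -expR0 ler_expR oppr_le0 divr_ge0.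
have -> : p ^+ 2 - 2 + q ^+ 2 = (p - q) ^+ 2 by rewrite sqrrB -mulr_natl pq; ring.
have : v / 2 <= p - q by lra.
move=> H; have : (v / 2) ^+ 2 <= (p - q) ^+ 2 by rewrite ler_sqr// nnegrE; lra.
by rewrite expr_div_n; lra.
Qed.

Lemma normc_gamma_fun x (t : R) : normc (gamma_fun x%:C t) =
  (if 0 < t then expR ((x - 1) * ln t) * expR (- t) else 0).
Proof.
rewrite /gamma_fun indicC_pos; case: ifP => _; last by rewrite mul0r normc0.
by rewrite mul1r normcM normc_rpowc normc_real ger0_norm ?expR_ge0.
Qed.

Lemma absGammaE x : 0 < x ->
  (\int[leb]_t (normc (gamma_fun x%:C t))%:E = (absGamma x)%:E)%E.
Proof.
move=> x0; have H : 0 < complex.Re x%:C by [].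
exact: hasc_normc (has_cintegral_gamma H).
Qed.

Lemma absGamma_gt0 x : 0 < x -> 0 < absGamma x.
Proof.
move=> x0; pose m := expR (- (`|x - 1| * 2) - 2).
have m0 : 0 < m by exact: expR_gt0.
apply: (lt_le_trans m0); rewrite -lee_fin -absGammaE//.
apply: (@le_trans _ _ (\int[leb]_t (m * \1_`[1, 2] t)%:E)%E).
  under eq_integral do rewrite EFinM.
  rewrite ge0_integralZl//; last 2 first.
  - exact/measurable_EFinP/measurable_indic.
  - exact: (ltW m0).
  have L : leb (`[1, 2]%classic : set R) = 1%E.
    rewrite lebesgue_measure_itv/= lte_fin ltr1n -EFinB; congr EFin; lra.
  by rewrite integral_indic// setIT [X in (_ * X)%E]L mule1.
apply: ge0_le_integral => //.
- by move=> t _; rewrite lee_fin mulr_ge0// ltW.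
- by apply/measurable_EFinP; apply: measurable_funM => //; exact: measurable_indic.
- by apply/measurable_EFinP/measurable_normc/cmeasurable_gamma_fun.
move=> t _; rewrite lee_fin indicE.
have [|_] := boolP (t \in _); last by rewrite mulr0 normc_ge0.
rewrite inE/= in_itv/= mulr1 => /andP[t1 t2].
have t0 : 0 < t by rewrite (lt_le_trans _ t1).
rewrite normc_gamma_fun t0 -expRD ler_expR.
have ln0 : 0 <= ln t by exact: ln_ge0.
have ln2 : ln t <= 2 by rewrite (le_trans _ t2)// ltW// ln_sublinear.
suff : - (`|x - 1| * 2) <= (x - 1) * ln t by lra.
rewrite lerNl -mulNr (le_trans (_ : _ <= `|x - 1| * ln t))//.
  by rewrite ler_wpM2r//; have := ler_norm (- (x - 1)); rewrite normrN; lra.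
by rewrite ler_wpM2l.
Qed.

(** The mass of [t ^ (x - 1) e^{-t}] concentrates at [t = x] with relative
    width [x ^ (-1/2)], so the oscillation of [t ^ (iy)] is harmless there:
    integrated against the density, the bound on [cos (y ln (t / x))] gives
    [Re (x ^ (-iy) Gamma (x + iy)) >= Gamma (x - 1) (x - 1 - 2 y ^ 2)]. *)
Lemma cGamma_neq0_large x y : 2 + 2 * y ^+ 2 < x -> cGamma (x +i* y) != 0.
Proof.
move=> xy; apply/eqP => G0.
have y2 : 0 <= y ^+ 2 by exact: sqr_ge0.
have x0 : 0 < x by lra.
have x1 : 0 < x - 1 by lra.
have z0 : 0 < complex.Re (x +i* y) by [].
have := has_cintegralZ (rpowc x (0 -i* y)) (has_cintegral_gamma z0).
rewrite G0 mulr0 => H.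
have iR := normc_integrable_Re (hasc_measurable H) (hasc_integrable_normc H).
have mNg w := measurable_normc (@cmeasurable_gamma_fun R w%:C).
have iN w : 0 < w -> leb.-integrable setT
    (fun t : mR => (normc (gamma_fun w%:C t))%:E).
  move=> w0; have w0' : 0 < complex.Re w%:C by [].
  exact: hasc_integrable_normc (has_cintegral_gamma w0').
(* [cos (y ln s) >= 1 - (y ln s)^2 / 2 >= 1 - c (s - 2 + 1 / s)] *)
pose c := 2 * y ^+ 2.
have pt (t : R) : (1 + 2 * c) * normc (gamma_fun x%:C t) +
    (- (c / x) * normc (gamma_fun (x + 1)%:C t) +
     - (c * x) * normc (gamma_fun (x - 1)%:C t)) <=
    complex.Re (rpowc x (0 -i* y) * gamma_fun (x +i* y) t).
  have [t0|t0] := ltP 0 t; last first.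
    by rewrite !normc_gamma_fun /gamma_fun indicC_pos ltNge t0/= mul0r mulr0 !mulr0 !addr0.
  pose N := expR ((x - 1) * ln t) * expR (- t).
  have N0 : 0 <= N by rewrite mulr_ge0 ?expR_ge0.
  rewrite !normc_gamma_fun t0 -/N.
  have -> : expR ((x + 1 - 1) * ln t) * expR (- t) = t * N.
    rewrite (_ : (x + 1 - 1) * ln t = (x - 1) * ln t + ln t); last by ring.
    by rewrite expRD lnK// /N; ring.
  have -> : expR ((x - 1 - 1) * ln t) * expR (- t) = t^-1 * N.
    rewrite (_ : (x - 1 - 1) * ln t = (x - 1) * ln t - ln t); last by ring.
    by rewrite expRB lnK// /N; ring.
  have -> : complex.Re (rpowc x (0 -i* y) * gamma_fun (x +i* y) t) =
      cos (y * ln (t / x)) * N.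
    rewrite /gamma_fun indicC_pos t0 mul1r !rpowcE/= ln_div//.
    rewrite (_ : y * (ln t - ln x) = y * ln t - y * ln x); last by ring.
    by rewrite cosB mul0r expR0 mulNr cosN sinN subr0 /N; ring.
  have := cos_lower (y * ln (t / x)); rewrite exprMn => Hc.
  have := ler_wpM2l y2 (sqr_ln_le (divr_gt0 t0 x0)); rewrite invf_div => Hl.
  apply: le_trans (ler_wpM2r N0 (_ : 1 - c * (t / x - 2 + x / t) <= _)); last first.
    by rewrite (le_trans _ Hc)// /c; lra.
  by rewrite le_eqVlt; apply/orP; left; apply/eqP; ring.
have x10 : 0 < x + 1 by lra.
have I1 := integrableZl measurableT (1 + 2 * c) (iN _ x0).
have I2 := integrableZl measurableT (- (c / x)) (iN _ x10).
have I3 := integrableZl measurableT (- (c * x)) (iN _ x1).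
have := le_integral measurableT (integrableD measurableT I1
  (integrableD measurableT I2 I3)) iR (fun t _ => _).
rewrite (hasc_Re H)/=.
rewrite integralD//; last exact: integrableD.
rewrite integralD//.
rewrite !integralZl ?absGammaE//; [|exact: iN..].
have E : absGamma x = (x - 1) * absGamma (x - 1) by rewrite -absGammaS// subrK.
have g0 : 0 < absGamma (x - 1) by exact: absGamma_gt0.
rewrite absGammaS// E -!EFinM -!EFinD lee_fin => K.
have {}K : (1 + 2 * c) * ((x - 1) * absGamma (x - 1)) +
    (- (c / x) * (x * ((x - 1) * absGamma (x - 1))) + - (c * x) * absGamma (x - 1)) <= 0.
  by apply: K => t; rewrite -!EFinM -!EFinD lee_fin.
have x'0 : x != 0 by rewrite gt_eqF.
have : ((x - 1) - c) * absGamma (x - 1) <= 0.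
  apply: le_trans K; rewrite le_eqVlt; apply/orP; left; apply/eqP; field.
  by [].
by rewrite pmulr_lle0// /c; lra.
Qed.

(** The functional equation carries a zero to [z + n] for every [n], with the same
    imaginary part. *)
Lemma cGamma_neq0 z : 0 < complex.Re z -> cGamma z != 0.
Proof.
move=> z0; apply/eqP => G0.
have H n : cGamma (z + n%:R) = 0 /\ 0 < complex.Re (z + n%:R).
  elim: n => [|n [IH1 IH2]]; first by rewrite addr0.
  rewrite -natr1 addrA; split; first by rewrite cGammaS// IH1 mulr0.
  by rewrite raddfD/= addr_gt0.
pose y := complex.Im z; pose n := (Num.truncn (2 + 2 * y ^+ 2)).+1.
have := @cGamma_neq0_large (complex.Re z + n%:R) y.
rewrite (_ : _ +i* _ = z + n%:R); last first.
  rewrite /y -(rmorph_nat (real_complex R)); case: (z) => a b.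
  by apply/eqP; rewrite eq_complex/= addr0 !eqxx.
rewrite (H n).1 eqxx => /(_ _)/negP; apply => //.
by rewrite (lt_le_trans (truncnS_gt _))// lerDr ltW.
Qed.

End GammaNonzero.

(** * Positive quadratic forms and Schur complements *)

Section PositiveForms.
Variable R : realFieldType.

(** Positivity of the quadratic form, without symmetry: for [A] real this is
    dissipativity. *)
Definition pos_form n (A : 'M[R]_n) :=
  forall v : 'cV[R]_n, v != 0 -> 0 < (v^T *m A *m v) 0 0.

Lemma pos_form_unit n (A : 'M[R]_n) : pos_form A -> A \in unitmx.
Proof.
move=> pA; rewrite -unitmx_tr -row_free_unit -kermx_eq0; apply/rowV0P => v.
move/sub_kermxP => vA; apply: contraTeq isT => v0.
have := pA v^T; rewrite trmx_eq0 => /(_ v0).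
by rewrite trmxK -mulmxA -[A *m v^T]trmxK trmx_mul trmxK vA trmx0 mulmx0 mxE ltxx.
Qed.

Lemma pos_form_congr m n (A : 'M[R]_n) (L : 'M[R]_(n, m)) :
  (forall v : 'cV_m, L *m v = 0 -> v = 0) -> pos_form A ->
  pos_form (L^T *m A *m L).
Proof.
move=> injL pA v v0; have := pA (L *m v); rewrite trmx_mul !mulmxA; apply.
by apply: contra_neq v0; exact: injL.
Qed.

Lemma pos_formD n (A B : 'M[R]_n) :
  pos_form A -> (forall v : 'cV_n, 0 <= (v^T *m B *m v) 0 0) -> pos_form (A + B).
Proof.
move=> pA pB v v0; rewrite mulmxDr mulmxDl mxE.
by rewrite ltr_wpDr// pA.
Qed.

Lemma sqr_form_ge0 n (v : 'cV[R]_n) : 0 <= (v^T *m v) 0 0.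
Proof.
rewrite mxE sumr_ge0// => i _; rewrite !mxE -expr2; exact: sqr_ge0.
Qed.

Lemma pos_form1 n : pos_form (1%:M : 'M[R]_n).
Proof.
move=> v v0; rewrite mulmx1 lt_neqAle sqr_form_ge0 andbT eq_sym.
apply: contra v0 => /eqP; rewrite mxE => /eqP.
rewrite psumr_eq0 => [/allP H|i _]; last by rewrite !mxE -expr2 sqr_ge0.
apply/eqP/matrixP => i j; rewrite ord1 [RHS]mxE.
have := H i; rewrite mem_index_enum !mxE -expr2 sqrf_eq0.
by move=> /(_ isT)/eqP.
Qed.

Lemma form_skew n (S : 'M[R]_n) (w : 'cV[R]_n) : S^T = - S ->
  (w^T *m S *m w) 0 0 = 0.
Proof.
move=> skS; set x := _ 0 0.
have : x = - x.
  rewrite {1}/x -[w^T *m S *m w]trmxK [LHS]mxE !trmx_mul trmxK skS mulmxA.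
  by rewrite mulmxN mulNmx mxE.
by move/eqP; rewrite -addr_eq0 -mulr2n mulrn_eq0 => /eqP.
Qed.

Lemma form_scalar (a : 'M[R]_1) (v : 'cV[R]_1) :
  (v^T *m a *m v) 0 0 = v 0 0 ^+ 2 * a 0 0.
Proof. by rewrite !mxE !big_ord1 !mxE big_ord1 !mxE; ring. Qed.

Lemma pos_form_scalar (a : 'M[R]_1) : pos_form a <-> 0 < a 0 0.
Proof.
split=> [pa|a0 v v0].
  have := pa (const_mx 1); rewrite form_scalar mxE expr1n mul1r; apply.
  by apply/eqP => /matrixP /(_ 0 0); rewrite !mxE => /eqP; rewrite oner_eq0.
rewrite form_scalar pmulr_lgt0// lt_neqAle sqr_ge0 eq_sym sqrf_eq0 andbT.
by apply: contra v0 => /eqP v0; apply/eqP/matrixP => i j; rewrite !ord1 v0 mxE.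
Qed.

Lemma block_formE m n (P : 'M[R]_m) U V (D : 'M[R]_n) (v : 'cV_m) (w : 'cV_n) :
  (col_mx v w)^T *m block_mx P U V D *m col_mx v w =
  v^T *m P *m v + v^T *m U *m w + w^T *m V *m v + w^T *m D *m w.
Proof.
rewrite tr_col_mx mul_row_block mul_row_col !mulmxDl.
by rewrite addrACA !addrA; congr (_ + _); rewrite addrAC.
Qed.

Lemma pos_form_ul m n (P : 'M[R]_m) U V (D : 'M[R]_n) :
  pos_form (block_mx P U V D) -> pos_form P.
Proof.
move=> pM v v0; have := pM (col_mx v 0).
rewrite block_formE mulmx0 trmx0 !mul0mx !addr0; apply.
by apply: contra v0; rewrite -col_mx0 => /eqP/eq_col_mx[-> _].
Qed.

Definition schur m n (P : 'M[R]_m) U V (D : 'M[R]_n) := D - V *m invmx P *m U.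

Lemma det_schur m n (P : 'M[R]_m) U V (D : 'M[R]_n) : P \in unitmx ->
  \det (block_mx P U V D) = \det P * \det (schur P U V D).
Proof.
move=> uP.
have -> : block_mx P U V D =
    block_mx 1%:M 0 (V *m invmx P) 1%:M *m block_mx P U 0 (schur P U V D).
  rewrite mulmx_block !mul1mx !mul0mx !addr0 mulmxKV//.
  by rewrite /schur addrC subrK.
by rewrite det_mulmx det_lblock !det1 !mul1r det_ublock.
Qed.

(** The vector [(- P^-1 U w, w)] sees only the Schur complement. *)
Lemma pos_form_schur m n (P : 'M[R]_m) U V (D : 'M[R]_n) :
  pos_form (block_mx P U V D) -> pos_form (schur P U V D).
Proof.
move=> pM w w0; have uP := pos_form_unit (pos_form_ul pM).
have := pM (col_mx (- (invmx P *m U *m w)) w).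
rewrite -[(_^T *m block_mx _ _ _ _) *m _]mulmxA mul_block_col tr_col_mx mul_row_col.
rewrite mulmxN !mulmxA mulmxV// mul1mx addNr mulmx0 add0r.
rewrite (_ : V *m _ + _ = schur P U V D *m w).
  rewrite mulmxA; apply; apply: contra w0.
  by rewrite -col_mx0 => /eqP/eq_col_mx[_ ->].
by rewrite /schur mulmxBl mulmxN addrC !mulmxA.
Qed.

Lemma pos_form_det n (A : 'M[R]_n) : pos_form A -> 0 < \det A.
Proof.
elim: n A => [|n IH] A pA; first by rewrite det_mx00.
move: A pA; rewrite -addn1 => A; rewrite -[A]submxK => pA.
rewrite det_schur ?(pos_form_unit (pos_form_ul pA))//.
apply: mulr_gt0; first exact/IH/(pos_form_ul pA).
by rewrite det_mx11; apply/pos_form_scalar/pos_form_schur.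
Qed.

Lemma unitmx_inj n (L : 'M[R]_n) (v : 'cV_n) : L \in unitmx -> L *m v = 0 -> v = 0.
Proof. by move=> uL Lv; rewrite -[v](mulKmx uL) Lv mulmx0. Qed.

Lemma pos_form_block_diag m n (P : 'M[R]_m) (D : 'M[R]_n) :
  pos_form P -> pos_form D -> pos_form (block_mx P 0 0 D).
Proof.
move=> pP pD v; rewrite -[v]vsubmxK block_formE !mulmx0 !mul0mx !addr0 => v0.
rewrite mxE; have [u0|u0] := eqVneq (usubmx v) 0; last first.
  rewrite ltr_pwDl ?pP//; have [->|d0] := eqVneq (dsubmx v) 0.
    by rewrite mulmx0 mxE.
  by rewrite ltW// pD.
rewrite u0 mulmx0 mxE add0r pD//; apply: contra_neq v0 => d0.
by rewrite u0 d0 col_mx0.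
Qed.

(** Block elimination turns the form into the sum of those of [P] and of the
    Schur complement. *)
Lemma pos_form_of_schur m n (P : 'M[R]_m) U (D : 'M[R]_n) : P^T = P ->
  pos_form P -> pos_form (schur P U U^T D) -> pos_form (block_mx P U U^T D).
Proof.
move=> sP pP pS; have uP := pos_form_unit pP.
pose L := block_mx 1%:M (invmx P *m U) 0 1%:M : 'M[R]_(m + n).
have -> : block_mx P U U^T D = L^T *m block_mx P 0 0 (schur P U U^T D) *m L.
  rewrite /L tr_block_mx !trmx1 trmx0 trmx_mul trmx_inv sP mulmx_block.
  rewrite !mulmx0 !mul0mx !mul1mx !addr0 !add0r mulmx_block !mulmx0 !mulmx1.
  rewrite !addr0 mulmxKV// mulKVmx// mulmxA.
  by rewrite /schur addrC subrK.
apply: pos_form_congr; last exact: pos_form_block_diag.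
by move=> v; apply: unitmx_inj; rewrite unitmxE /L det_ublock !det1 mulr1 unitr1.
Qed.

Lemma pos_form_inv n (A : 'M[R]_n) : A^T = A -> pos_form A -> pos_form (invmx A).
Proof.
move=> sA pA; have uA := pos_form_unit pA.
have -> : invmx A = (invmx A)^T *m A *m invmx A.
  by rewrite trmx_inv sA mulVmx// mul1mx.
apply: pos_form_congr => // v; apply: unitmx_inj; by rewrite unitmx_inv.
Qed.

End PositiveForms.

(** * The form attached to a bordered dissipative matrix *)

Section Bordering.
Variables (R : realFieldType) (n : nat) (T S : 'M[R]_n).
Hypotheses (symT : T^T = T) (posT : pos_form T) (skewS : S^T = - S).

Let H := 1%:M + T.
Let A := 1%:M + T + S.
Let a := invmx A.

Lemma pos_form_1T : pos_form H.
Proof.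
apply: pos_formD; first exact: pos_form1.
by move=> v; have [->|/posT/ltW//] := eqVneq v 0; rewrite mulmx0 mxE.
Qed.

Lemma pos_form_1TS : pos_form A.
Proof.
apply: pos_formD; first exact: pos_form_1T.
by move=> v; rewrite form_skew// skewS.
Qed.

Let symH : H^T = H. Proof. by rewrite /H linearD/= trmx1 symT. Qed.
Let uH : H \in unitmx. Proof. exact: pos_form_unit pos_form_1T. Qed.
Let uT : T \in unitmx. Proof. exact: pos_form_unit posT. Qed.
Let uA : A \in unitmx. Proof. exact: pos_form_unit pos_form_1TS. Qed.
Let uAT : A^T \in unitmx. Proof. by rewrite unitmx_tr. Qed.

(** Expanding the last determinant of [1 + T + S] along the border given by
    [t] (in [T]) and [s] (in [S]) produces this form in [(s, t)]. *)
Definition border_form : 'M[R]_(n + n) :=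
  let B := 2^-1 *: (a + a^T) in
  let C := 2^-1 *: (a - a^T) in
  block_mx B C C^T (invmx T - B).

Let B := 2^-1 *: (a + a^T).
Let C := 2^-1 *: (a - a^T).

(** Congruence by [a] carries [A^T], hence the symmetric part [H] of [A], to that
    of [a = A^-1]. *)
Let BE : B = a *m H *m a^T.
Proof.
have HE : H = 2^-1 *: (A + A^T).
  apply/matrixP => i j; have := congr1 (fun M => fun_of_matrix M i j) skewS.
  have := congr1 (fun M => fun_of_matrix M i j) symT.
  by rewrite /A /H !mxE [j == i]eq_sym; lra.
rewrite HE -scalemxAr -scalemxAl mulmxDr mulmxDl /a mulVmx// mul1mx.
by rewrite trmx_inv mulmxK// -trmx_inv addrC.
Qed.

Let symB : B^T = B.
Proof. by rewrite /B linearZ/= linearD/= trmxK addrC. Qed.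

Let posB : pos_form B.
Proof.
rewrite BE -{1}[a]trmxK; apply: pos_form_congr; last exact: pos_form_1T.
by move=> v; apply: unitmx_inj; rewrite unitmx_tr unitmx_inv.
Qed.

Let uB : B \in unitmx. Proof. exact: pos_form_unit posB. Qed.

Let invB : a^T *m invmx B *m a = invmx H.
Proof.
have -> : invmx B = A^T *m invmx H *m A.
  apply: (can_inj (mulKmx uB)); rewrite mulmxV// BE.
  rewrite !mulmxA /a trmx_inv mulmxKV// mulmxK// mulVmx//.
by rewrite !mulmxA /a trmx_inv mulVmx// mul1mx mulmxK.
Qed.

(** Since [C = a - B] and [a^T B^-1 a = H^-1], the Schur complement of [B] is
    [T^-1 - H^-1 = (H T)^-1]: this is what makes the form positive and its
    determinant explicit. *)
Let schurE : schur B C C^T (invmx T - B) = invmx (H *m T).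
Proof.
have CE : C = a - B by apply/matrixP => i j; rewrite !mxE; lra.
have CTE : C^T = a^T - B by rewrite CE linearB/= symB.
have aB : a^T = B + B - a by apply/matrixP => i j; rewrite !mxE; lra.
have -> : schur B C C^T (invmx T - B) = invmx T - invmx H.
  rewrite /schur CTE CE -invB !mulmxBl mulmxV// mul1mx mulmxBr mulmxKV//.
  by rewrite {2}aB; apply/matrixP => i j; rewrite !mxE; lra.
have -> : invmx (H *m T) = invmx T *m invmx H.
  apply: (can_inj (mulKmx (_ : H *m T \in unitmx))).
  + by rewrite unitmx_mul uH.
  + by rewrite mulmxV ?unitmx_mul ?uH// -mulmxA mulKVmx// mulmxV.
have HT : 1%:M = H - T by rewrite /H addrK.
by rewrite -[X in _ = X *m _]mulmx1 HT mulmxBr mulmxBl mulmxK// mulVmx// mul1mx.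
Qed.

Let border_formB : border_form = block_mx B C C^T (invmx T - B).
Proof. by []. Qed.

Lemma border_form_pos : pos_form border_form.
Proof.
apply: pos_form_of_schur => //; rewrite schurE; apply: pos_form_inv.
  by rewrite trmx_mul symT symH /H mulmxDl mulmxDr mul1mx mulmx1.
rewrite /H mulmxDl mul1mx; apply: pos_formD => // v.
by rewrite -{1}symT mulmxA -mulmxA -trmx_mul sqr_form_ge0.
Qed.

Lemma border_form_sym : border_form^T = border_form.
Proof.
rewrite border_formB tr_block_mx trmxK symB linearB/= symB.
by rewrite trmx_inv symT.
Qed.

Lemma det_border_form : \det border_form = (\det T * \det A ^+ 2)^-1.
Proof.
rewrite border_formB det_schur// schurE det_inv BE !det_mulmx det_tr.
rewrite /a det_inv.
move: (pos_form_det posT) (pos_form_det pos_form_1T) (pos_form_det pos_form_1TS).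
move: (\det T) (\det H) (\det A) => x y z x0 y0 z0.
by field; rewrite !gt_eqF.
Qed.

(** The symmetric part [B] of [a] pairs [t] with [t] and [s] with [s], its skew
    part [C] pairs [s] with [t]. *)
Lemma border_formE (s t : 'cV[R]_n) :
  ((col_mx s t)^T *m border_form *m col_mx s t) 0 0 =
  (t^T *m invmx T *m t) 0 0 - ((t - s)^T *m a *m (t + s)) 0 0.
Proof.
rewrite border_formB block_formE.
pose f (M : 'M[R]_n) (v w : 'cV[R]_n) := (v^T *m M *m w) 0 0.
have fD M N v w : f (M + N) v w = f M v w + f N v w.
  by rewrite /f mulmxDr mulmxDl mxE.
have fN M v w : f (- M) v w = - f M v w by rewrite /f mulmxN mulNmx mxE.
have fZ k M v w : f (k *: M) v w = k * f M v w.
  by rewrite /f -scalemxAr -scalemxAl mxE.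
have fT M v w : f M^T v w = f M w v.
  have tr1 (X : 'M[R]_1) : X 0 0 = X^T 0 0 by rewrite mxE.
  by rewrite /f tr1 !trmx_mul !trmxK mulmxA.
have fDr M v w u : f M v (w + u) = f M v w + f M v u by rewrite /f mulmxDr mxE.
have fDl M v w u : f M (v + w) u = f M v u + f M w u.
  by rewrite /f linearD/= !mulmxDl mxE.
have fNl M v w : f M (- v) w = - f M v w by rewrite /f linearN/= !mulNmx mxE.
have -> : (s^T *m B *m s + s^T *m C *m t + t^T *m C^T *m s +
   t^T *m (invmx T - B) *m t) 0 0 =
   f B s s + f C s t + f C^T t s + f (invmx T - B) t t.
  by rewrite mxE [X in X + _]mxE [X in X + _ + _]mxE.
rewrite -/(f _ _ _) -/(f a (t - s) (t + s)) fT /B /C.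
by rewrite !(fD, fN, fZ, fT, fDr, fDl, fNl); lra.
Qed.

End Bordering.

(** * Gaussian integrals *)

Section MatrixMeasurable.
Context d (T : measurableType d) (R : realType).

Definition mx_measurable m n (X : T -> 'M[R]_(m, n)) :=
  forall i j, measurable_fun setT (fun x => X x i j).

Lemma mx_measurable_cst m n (A : 'M[R]_(m, n)) : mx_measurable (fun=> A).
Proof. by move=> i j; exact: measurable_cst. Qed.

Lemma mx_measurableM m n p (X : T -> 'M[R]_(m, n)) (Y : T -> 'M[R]_(n, p)) :
  mx_measurable X -> mx_measurable Y -> mx_measurable (fun x => X x *m Y x).
Proof.
move=> mX mY i j; under eq_fun do rewrite mxE.
by apply: measurable_sum => k; exact: measurable_funM.
Qed.

Lemma mx_measurableD m n (X Y : T -> 'M[R]_(m, n)) :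
  mx_measurable X -> mx_measurable Y -> mx_measurable (fun x => X x + Y x).
Proof.
by move=> mX mY i j; under eq_fun do rewrite mxE; exact: measurable_funD.
Qed.

Lemma mx_measurable_tr m n (X : T -> 'M[R]_(m, n)) :
  mx_measurable X -> mx_measurable (fun x => (X x)^T).
Proof. by move=> mX i j; under eq_fun do rewrite mxE; exact: mX. Qed.

Lemma mx_measurable_det n (X : T -> 'M[R]_n) :
  mx_measurable X -> measurable_fun setT (fun x => \det (X x)).
Proof.
move=> mX; apply: measurable_sum => s; apply: measurable_funM => //.
by apply: measurable_prod => i _.
Qed.

End MatrixMeasurable.

Section Gauss.
Variable R : realType.
Local Notation mR := (measurableTypeR R).
Local Notation leb := (@lebesgue_measure R).

Lemma has_cintegral_gauss1 (a c : R) : 0 < a ->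
  has_cintegral leb (fun x : mR => (expR (- (a * (x + c) ^+ 2)))%:C)
    (Num.sqrt pi / Num.sqrt a)%:C (Num.sqrt pi / Num.sqrt a).
Proof.
move=> a0; pose s := Num.sqrt (a *+ 2)^-1.
have s2 : s ^+ 2 = (a *+ 2)^-1 by rewrite sqr_sqrtr// invr_ge0 mulrn_wge0// ltW.
have s0 : s != 0 by rewrite -sqrf_eq0 s2 invr_eq0 mulrn_eq0/= gt_eqF.
have pE : normal_peak s = Num.sqrt a / Num.sqrt pi.
  rewrite /normal_peak s2 (_ : _ *+ 2 = pi / a); last first.
    rewrite -(mulr_natr a) -(mulr_natr (_ * _)).
    by field; rewrite gt_eqF.
  by rewrite sqrtrM ?pi_ge0// sqrtrV ?ltW// invf_div.
have p0 : 0 < Num.sqrt (pi : R) by rewrite sqrtr_gt0 pi_gt0.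
have q0 : 0 < Num.sqrt a by rewrite sqrtr_gt0.
have me : measurable_fun setT (fun x : mR => expR (- (a * (x + c) ^+ 2))).
  apply: measurable_expRN; apply: measurable_funM => //.
  by apply: measurable_funX; apply: measurable_funD.
apply: has_cintegral_ge0 => //.
have : (\int[leb]_x ((normal_peak s)%:E * (expR (- (a * (x + c) ^+ 2)))%:E) = 1)%E.
  rewrite -(integral_normal_pdf (- c) s) normal_pdfE//; apply: eq_integral => x _.
  rewrite -EFinM /normal_fun opprK s2 -(mulr_natr _^-1) -(mulr_natr a).
  congr (_ * expR _)%:E; field.
  by rewrite gt_eqF.
rewrite ge0_integralZl//; last 2 first.
- exact/measurable_EFinP.
- by rewrite lee_fin normal_peak_ge0.
rewrite pE; set I := (\int[_]_x _)%E => H.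
have: ((Num.sqrt pi / Num.sqrt a)%:E * ((Num.sqrt a / Num.sqrt pi)%:E * I) = (Num.sqrt pi / Num.sqrt a)%:E)%E.
  by rewrite H mule1.
rewrite muleA -EFinM (_ : _ * _ = 1) ?mul1e//.
by field; rewrite !gt_eqF.
Qed.

Definition col_of_tuple n (x : n.-tuple mR) : 'cV[R]_n := \col_i tnth x i.

Lemma mx_measurable_col n : mx_measurable (@col_of_tuple n).
Proof.
by move=> i j; under eq_fun do rewrite mxE; exact: measurable_tnth.
Qed.

Lemma measurable_form n (M : 'M[R]_n) :
  measurable_fun setT (fun x : n.-tuple mR =>
    ((col_of_tuple x)^T *m M *m col_of_tuple x) 0 0).
Proof.
apply: mx_measurableM; last exact: mx_measurable_col.
apply: mx_measurableM; last exact: mx_measurable_cst.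
by apply: mx_measurable_tr; exact: mx_measurable_col.
Qed.

(** Arranged so that the first coordinate is the one integrated first. *)
Lemma has_cintegral_tuple_cons n (f : n.+1.-tuple mR -> R[i]) v w :
  cmeasurable f ->
  has_cintegral (lebesgue_tuple R n \x leb)%E (fun z => f (tuple_cons (z.2, z.1))) v w ->
  has_cintegral (lebesgue_tuple R n.+1) f v w.
Proof.
move=> mf H; apply/(has_cintegral_pushforward (phi := @tuple_cons R n)
  (mu := (leb \x lebesgue_tuple R n)%E)) => //.
  exact: measurable_tuple_cons.
have := has_cintegral_swap H.
by apply: has_cintegral_ext => -[x0 x].
Qed.

(** Complete the square in the first variable, which leaves the form of the
    Schur complement in the others. *)
Lemma has_cintegral_gauss n (M : 'M[R]_n) : M^T = M -> pos_form M ->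
  has_cintegral (lebesgue_tuple R n)
    (fun x => (expR (- ((col_of_tuple x)^T *m M *m col_of_tuple x) 0 0))%:C)
    (Num.sqrt pi ^+ n / Num.sqrt (\det M))%:C
    (Num.sqrt pi ^+ n / Num.sqrt (\det M)).
Proof.
elim: n M => [|n IH] M.
  move=> _ _; rewrite det_mx00 expr0 sqrtr1 divr1.
  apply: has_cintegral_ge0 => //.
    by apply: measurable_expRN; exact: measurable_form.
  rewrite integral_dirac//; last first.
    by apply/measurable_EFinP; apply: measurable_expRN; exact: measurable_form.
  rewrite diracE mem_set// mul1e (_ : _ 0 0 = 0) ?oppr0 ?expR0//.
  by rewrite mxE big_ord0.
move: M; rewrite -[n.+1]/(1 + n)%N => M symM posM.
set P := ulsubmx M; set U := ursubmx M; set D := drsubmx M.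
have ME : M = block_mx P U U^T D.
  by rewrite -[LHS]submxK -/P -/U -/D -[in dlsubmx M]symM -trmx_ursub.
pose a := P 0 0.
have Pa : P = a%:M by rewrite [LHS]mx11_scalar.
rewrite ME in posM.
have a0 : 0 < a by have /pos_form_ul/pos_form_scalar := posM.
pose Q := schur P U U^T D.
have posQ : pos_form Q by exact: pos_form_schur.
have detM : \det M = a * \det Q.
  by rewrite ME det_schur ?det_mx11// Pa unitmxE det_scalar1 unitfE gt_eqF.
have QE : Q = D - a^-1 *: (U^T *m U).
  by rewrite /Q /schur Pa invmx_scalar mul_mx_scalar -scalemxAl.
have symQ : Q^T = Q.
  rewrite QE linearB/= linearZ/= trmx_mul trmxK; congr (_ - _).
  by rewrite /D trmx_drsub symM.
pose ell (x : n.-tuple mR) := (U *m col_of_tuple x) 0 0.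
have formE (x0 : mR) (x : n.-tuple mR) :
    ((col_of_tuple (tuple_cons (x0, x)))^T *m M *m
      col_of_tuple (tuple_cons (x0, x))) 0 0 =
    a * (x0 + ell x / a) ^+ 2 + ((col_of_tuple x)^T *m Q *m col_of_tuple x) 0 0.
  have -> : col_of_tuple (tuple_cons (x0, x)) = col_mx x0%:M (col_of_tuple x).
    apply/matrixP => i j; rewrite ord1 !mxE; case: splitP => k ik.
      rewrite mxE ord1 eqxx mulr1n (_ : i = ord0)//; last first.
        by apply: val_inj; rewrite /= ik ord1.
    rewrite mxE (_ : i = lift ord0 k) ?tnthS//.
    by apply: val_inj; rewrite /= ik.
  set w := col_of_tuple x.
  rewrite ME block_formE QE mulmxBr mulmxBl.
  rewrite -scalemxAr -scalemxAl !mulmxA.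
  have tr1 (X : 'M[R]_1) : X 0 0 = X^T 0 0 by rewrite mxE.
  have UE : U *m w = (ell x)%:M by rewrite [LHS]mx11_scalar.
  have wUE : w^T *m U^T = (ell x)%:M by rewrite -trmx_mul UE tr_scalar_mx.
  have YUE (Y : 'M[R]_1) : Y *m U *m w = Y *m (ell x)%:M by rewrite -mulmxA UE.
  rewrite wUE !YUE Pa tr_scalar_mx -!scalar_mxM !mxE !mulr1n.
  by field; rewrite gt_eqF.
have mf : cmeasurable (fun x : (1 + n)%N.-tuple mR =>
    (expR (- ((col_of_tuple x)^T *m M *m col_of_tuple x) 0 0))%:C).
  by apply: cmeasurable_real; apply: measurable_expRN; exact: measurable_form.
apply: (has_cintegral_tuple_cons mf).
have kE : Num.sqrt pi ^+ n.+1 / Num.sqrt (\det M) =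
    Num.sqrt pi / Num.sqrt a * (Num.sqrt pi ^+ n / Num.sqrt (\det Q)).
  by rewrite detM sqrtrM ?ltW// exprS invfM mulrACA.
rewrite kE rmorphM.
apply: has_cintegral_fubini (IH Q symQ posQ).
  apply: (cmeasurable_comp mf (h := fun z => tuple_cons (z.2, z.1))).
  apply: (measurableT_comp (@measurable_tuple_cons R n)).
  exact: (@measurable_swap _ _ (n.-tuple mR) mR).
move=> x; set g := expR _.
have := has_cintegralZ g%:C (has_cintegral_gauss1 (ell x / a) a0).
rewrite [X in has_cintegral _ _ X _ -> _]mulrC normc_real ger0_norm ?expR_ge0//.
rewrite [X in has_cintegral _ _ _ X -> _]mulrC.
apply: has_cintegral_ext => x0.
by rewrite /= formE opprD expRD rmorphM mulrC.
Qed.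

End Gauss.

(** * Integration over the last border *)

Section Border.
Variables (R : realType) (n : nat) (T S : 'M[R]_n).
Local Notation mR := (measurableTypeR R).
Local Notation leb := (@lebesgue_measure R).
Hypotheses (symT : T^T = T) (posT : pos_form T) (skewS : S^T = - S).
Variables (a sg : R[i]).
Hypotheses (a_gt0 : 0 < complex.Re a) (sga : 0 < complex.Re (sg - a - n%:R)).

Let A := 1%:M + T + S.
Let M := border_form T S.

Let detT : 0 < \det T. Proof. exact: pos_form_det. Qed.
Let detA : 0 < \det A. Proof. exact/pos_form_det/pos_form_1TS. Qed.
(** The inverse square root of the determinant of the form [M]. *)
Let kappa := Num.sqrt (\det T) * \det A.
Let kappa0 : 0 < kappa. Proof. by rewrite mulr_gt0// sqrtr_gt0. Qed.

Definition form_of (v : (n + n).-tuple mR) : R :=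
  ((col_of_tuple v)^T *m M *m col_of_tuple v) 0 0.

Definition tform_of (v : (n + n).-tuple mR) : R :=
  let t := dsubmx (col_of_tuple v) in (t^T *m invmx T *m t) 0 0.

Lemma form_of_ge0 v : 0 <= form_of v.
Proof.
rewrite /form_of; have [->|v0] := eqVneq (col_of_tuple v) 0.
  by rewrite mulmx0 mxE.
by rewrite ltW//; apply: (border_form_pos symT posT skewS).
Qed.

Lemma measurable_form_of : measurable_fun setT form_of.
Proof. exact: measurable_form. Qed.

Lemma measurable_tform_of : measurable_fun setT tform_of.
Proof.
have mt : mx_measurable (fun v : (n + n).-tuple mR => dsubmx (col_of_tuple v)).
  by move=> i j; under eq_fun do rewrite !mxE; exact: measurable_tnth.
apply: mx_measurableM => //; apply: mx_measurableM.
  exact: mx_measurable_tr.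
exact: mx_measurable_cst.
Qed.

Lemma has_cintegral_gauss_form (y : R) : 0 < y ->
  has_cintegral (lebesgue_tuple R (n + n)) (fun v => (expR (- (y * form_of v)))%:C)
    (pi ^+ n * kappa * y ^- n)%:C (pi ^+ n * kappa * y ^- n).
Proof.
move=> y0.
have symM : (y *: M)^T = y *: M by rewrite linearZ/= border_form_sym.
have posM : pos_form (y *: M).
  move=> v v0; rewrite -scalemxAr -scalemxAl mxE mulr_gt0//.
  exact: (border_form_pos symT posT skewS).
have := has_cintegral_gauss symM posM.
have -> : Num.sqrt pi ^+ (n + n) / Num.sqrt (\det (y *: M)) =
    pi ^+ n * kappa * y ^- n.
  rewrite detZ exprD -exprMn -expr2 sqr_sqrtr ?pi_ge0// -mulrA; congr (_ * _).
  rewrite (det_border_form symT posT skewS) sqrtrM ?exprn_ge0 ?ltW//.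
  rewrite exprD -expr2 sqrtr_sqr ger0_norm ?exprn_ge0 ?ltW// sqrtrV; last first.
    by rewrite mulr_ge0 ?sqr_ge0// ltW.
  rewrite sqrtrM ?ltW// sqrtr_sqr ger0_norm; last exact: ltW.
  by rewrite -/kappa invfM invrK mulrC.
apply: has_cintegral_ext => v; rewrite /form_of.
by rewrite -scalemxAr -scalemxAl mxE.
Qed.

(** The border is stored as its corner entry followed by [s] and [t]; [gap] is the
    Schur complement of [T] in the bordered symmetric matrix. *)
Let gap (z : (n + n).+1.-tuple mR) : R := thead z - tform_of (tuple_tail z).

(** The factors of the integrand that depend on the border. *)
Definition border_fun (z : (n + n).+1.-tuple mR) : R[i] :=
  (\1_`]0, +oo[ (gap z))%:C *
    (rpowc (gap z) (a - 1) * rpowc (1 + gap z + form_of (tuple_tail z) : R) (- sg)).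

(** Euler's integral for [(1 + u + Q) ^ (- sg)] turns the last border into a
    Gamma integral in [u] and a Gaussian one in [(s, t)]. *)
Definition border_kernel (p : mR * ((n + n).+1.-tuple mR)) : R[i] :=
  (\1_`]0, +oo[ p.1)%:C * (rpowc p.1 (sg - 1) * (expR (- p.1))%:C) *
  ((expR (- (p.1 * form_of (tuple_tail p.2))))%:C *
    ((\1_`]0, +oo[ (gap p.2))%:C *
      (rpowc (gap p.2) (a - 1) * (expR (- (p.1 * gap p.2)))%:C))).

Let mtail : measurable_fun setT (@tuple_tail R (n + n)).
Proof. exact: measurable_behead. Qed.

Let measurable_gap : measurable_fun setT gap.
Proof.
apply: measurable_funB; first exact: measurable_tnth.
exact: (measurableT_comp measurable_tform_of mtail).
Qed.

Let measurable_form_fst :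
  measurable_fun setT (fun z : (n + n).+1.-tuple mR => form_of (tuple_tail z)).
Proof. exact: (measurableT_comp measurable_form_of mtail). Qed.

Let cmeasurable_pos_gap : cmeasurable (fun z => (\1_`]0, +oo[ (gap z) : R)%:C).
Proof.
apply: (cmeasurable_comp (f := fun t : mR => (\1_`]0, +oo[ t : R)%:C)) => //.
exact: cmeasurable_indic.
Qed.

Lemma cmeasurable_border_fun : cmeasurable border_fun.
Proof.
apply: cmeasurableM => //; apply: cmeasurableM; apply: cmeasurable_rpowc => //.
by apply: measurable_funD => //; apply: measurable_funD.
Qed.

Lemma cmeasurable_border_kernel : cmeasurable border_kernel.
Proof.
have m21 : measurable_fun setT
    (fun p : mR * ((n + n).+1.-tuple mR) => form_of (tuple_tail p.2)).
  exact: (measurableT_comp measurable_form_fst measurable_snd).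
have mg : measurable_fun setT
    (fun p : mR * ((n + n).+1.-tuple mR) => gap p.2).
  exact: (measurableT_comp measurable_gap measurable_snd).
apply: cmeasurableM.
  exact: (cmeasurable_comp (cmeasurable_gamma_fun sg) measurable_fst).
apply: cmeasurableM.
  apply: cmeasurable_real; apply: measurable_expRN; exact: measurable_funM.
apply: cmeasurableM.
  exact: (cmeasurable_comp cmeasurable_pos_gap measurable_snd).
apply: cmeasurableM; first exact: cmeasurable_rpowc.
by apply: cmeasurable_real; apply: measurable_expRN; exact: measurable_funM.
Qed.

Let k := pi ^+ n * kappa.
Let k0 : 0 < k. Proof. by rewrite mulr_gt0// exprn_gt0// pi_gt0. Qed.

Lemma has_cintegral_border_kernel :
  has_cintegral (leb \x lebesgue_tuple R (n + n).+1)%E border_kernel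
    (cGamma a * k%:C * cGamma (sg - a - n%:R))
    (absGamma (complex.Re a) * k * absGamma (complex.Re (sg - a - n%:R))).
Proof.
apply: has_cintegral_fubini (has_cintegral_gamma sga).
  exact: cmeasurable_border_kernel.
move=> y; rewrite /border_kernel /gamma_fun /= indicC_pos.
have [y0|y0] := ltP 0 y; last first.
  rewrite !mul0r normc0 !mulr0.
  by apply: has_cintegral0 => z; rewrite !mul0r.
pose f (z : (n + n).+1.-tuple mR) := (expR (- (y * form_of (tuple_tail z))))%:C *
    ((\1_`]0, +oo[ (gap z))%:C *
      (rpowc (gap z) (a - 1) * (expR (- (y * gap z)))%:C)).
have Hf : has_cintegral (lebesgue_tuple R (n + n).+1) f
    (cGamma a * rpowc y (- a) * (k * y ^- n)%:C)
    (absGamma (complex.Re a) * normc (rpowc y (- a)) * (k * y ^- n)).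
  have mf : cmeasurable f.
    apply: cmeasurableM.
      by apply: cmeasurable_real; apply: measurable_expRN; exact: measurable_funM.
    apply: cmeasurableM => //; apply: cmeasurableM; first exact: cmeasurable_rpowc.
    by apply: cmeasurable_real; apply: measurable_expRN; exact: measurable_funM.
  apply: (has_cintegral_tuple_cons mf).
  apply: has_cintegral_fubini (has_cintegral_gauss_form y0).
    apply: (cmeasurable_comp mf (h := fun z => tuple_cons (z.2, z.1))).
    apply: (measurableT_comp (@measurable_tuple_cons R (n + n))).
    exact: (@measurable_swap _ _ ((n + n).-tuple mR) mR).
  move=> v; have := has_cintegralZ (expR (- (y * form_of v)))%:C
    (has_cintegral_shift (tform_of v)
      (has_cintegral_gamma_scale y0 (has_cintegral_gamma a_gt0))).
  rewrite [X in has_cintegral _ _ X _ -> _]mulrC.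
  rewrite [X in has_cintegral _ _ _ X -> _]mulrC normc_real ger0_norm ?expR_ge0//.
  by apply: has_cintegral_ext => x; rewrite /f /gap tuple_consK theadE.
have := has_cintegralZ (rpowc y (sg - 1) * (expR (- y))%:C) Hf.
have E : rpowc y (sg - a - n%:R - 1) = rpowc y (sg - 1) * (rpowc y (- a) * (y ^- n)%:C).
  rewrite (_ : sg - a - n%:R - 1 = (sg - 1) + (- a + - n%:R)); last by ring.
  by rewrite !rpowcD [rpowc y (- n%:R)]rpowcN rpowc_nat// fmorphV.
rewrite E !mul1r.
have yn0 : 0 < y ^- n by rewrite invr_gt0 exprn_gt0.
move: (rpowc y (sg - 1)) (rpowc y (- a)) (y ^- n) yn0 (expR (- y)) => r1 r2 yn yn0 e.
rewrite (_ : r1 * _ * (_ * _) = cGamma a * k%:C * (r1 * (r2 * yn%:C) * e%:C)); last first.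
  by rewrite rmorphM; ring.
rewrite (_ : normc (r1 * _) * _ = absGamma (complex.Re a) * k *
    normc (r1 * (r2 * yn%:C) * e%:C)); last first.
  by rewrite !normcM [normc yn%:C]normc_real ger0_norm ?ltW//; ring.
by apply: has_cintegral_ext.
Qed.

(** Integrating the kernel over [y] instead gives [Gamma (sg)] times [border_fun];
    that factor is divided out, whence the need for Gamma not to vanish. *)
Lemma has_cintegral_border : 0 < complex.Re sg ->
  has_cintegral (lebesgue_tuple R (n + n).+1) border_fun
    (cGamma a * k%:C * cGamma (sg - a - n%:R) / cGamma sg)
    (absGamma (complex.Re a) * k * absGamma (complex.Re (sg - a - n%:R)) /
     absGamma (complex.Re sg)).
Proof.
move=> sg0.
apply: has_cintegral_fubiniV (has_cintegral_swap has_cintegral_border_kernel).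
- exact: cmeasurable_border_fun.
- exact: cGamma_neq0.
- by rewrite gt_eqF// absGamma_gt0.
move=> z; rewrite /border_kernel /border_fun /= !(indicC_pos (gap z)).
have [u0|u0] := ltP 0 (gap z); last first.
  rewrite !mul0r normc0 !mulr0.
  by apply: has_cintegral0 => y; rewrite mul0r !mulr0.
pose q := 1 + gap z + form_of (tuple_tail z).
have q0 : 0 < q by rewrite ltr_wpDr ?form_of_ge0// addr_gt0.
have := has_cintegralZ (rpowc (gap z) (a - 1))
  (has_cintegral_gamma_scale q0 (has_cintegral_gamma sg0)).
rewrite -/q !mul1r; move: (rpowc (gap z) (a - 1)) (rpowc q (- sg)) => r1 r2.
rewrite mulrCA [X in has_cintegral _ _ _ X -> _]mulrCA -normcM.
apply: has_cintegral_ext => y.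
have -> : expR (- (q * y)) =
    expR (- y) * (expR (- (y * form_of (tuple_tail z))) * expR (- (y * gap z))).
  by rewrite -!expRD; congr expR; rewrite /q; ring.
rewrite !rmorphM; move: (rpowc y _) => r3.
by rewrite mul1r; ring.
Qed.

End Border.

(** * Leading principal minors *)

Section LeadingMinors.
Variable R : realType.

Lemma det_ulblock_last n (M : 'M[R]_n) (j : 'I_n) :
  j.+1 = n -> \det (ulblock M j) = \det M.
Proof.
have gen p (f : 'I_p -> 'I_n) : p = n -> (forall i, f i = i :> nat) ->
    \det (mxsub f f M) = \det M.
  move=> pn; move: f; rewrite pn => f fE; congr (\det _).
  by apply/matrixP => i k; rewrite mxE; congr (M _ _); apply: val_inj; rewrite /= fE.
by move=> jn; apply: gen.
Qed.

Lemma ulblock_block n (P : 'M[R]_n) U V (D : 'M[R]_1) (j : 'I_n) :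
  ulblock (block_mx P U V D) (lshift 1 j) = ulblock P j.
Proof.
have E i : widen_ord (ltn_ord (lshift 1 j)) i = lshift 1 (widen_ord (ltn_ord j) i).
  exact: val_inj.
by apply/matrixP => i k; rewrite [LHS]mxE [RHS]mxE !E block_mxEul.
Qed.

Lemma ulblock_block_last n (M : 'M[R]_(n + 1)) (i : 'I_1) :
  \det (ulblock M (rshift n i)) = \det M.
Proof. by apply: det_ulblock_last; rewrite ord1 /= addn0 addn1. Qed.

(** Sylvester's criterion. *)
Lemma pos_form_minors n (T : 'M[R]_n) : T^T = T ->
  pos_form T <-> forall j, 0 < \det (ulblock T j).
Proof.
elim: n T => [|n IH] T symT.
  split=> [_ []//|_ v]; by rewrite [v]flatmx0 eqxx.
move: T symT; rewrite -addn1 => T symT.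
set P := ulsubmx T; set U := ursubmx T; set D := drsubmx T.
have TE : T = block_mx P U U^T D.
  by rewrite -[LHS]submxK -/P -/U -/D -[in dlsubmx T]symT -trmx_ursub.
have symP : P^T = P by rewrite trmx_ulsub symT.
split=> [pT j|dT].
  have pP : pos_form P by move: pT; rewrite TE; exact: pos_form_ul.
  case: (split_ordP j) => i ->.
    by rewrite TE ulblock_block; exact: (IH P symP).1.
  by rewrite ulblock_block_last; exact: pos_form_det.
have pP : pos_form P.
  by apply/IH => // j; have := dT (lshift 1 j); rewrite TE ulblock_block.
rewrite TE; apply: pos_form_of_schur => //; apply/pos_form_scalar.
have := dT (rshift n ord0); rewrite ulblock_block_last TE det_schur.
  by rewrite (pmulr_rgt0 _ (pos_form_det pP)) det_mx11.
exact: pos_form_unit.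
Qed.

Lemma pos_form_border n (T : 'M[R]_n) (t : 'cV[R]_n) (x : R) : T^T = T ->
  pos_form (block_mx T t t^T x%:M) <->
  pos_form T /\ 0 < x - (t^T *m invmx T *m t) 0 0.
Proof.
move=> symT; have sE : schur T t t^T x%:M 0 0 = x - (t^T *m invmx T *m t) 0 0.
  by rewrite /schur [LHS]mxE [X in X + _]mxE eqxx mulr1n [X in _ + X]mxE.
split=> [pT|[pT u0]].
  by split; [exact: pos_form_ul pT|rewrite -sE; apply/pos_form_scalar/pos_form_schur].
by apply: pos_form_of_schur => //; apply/pos_form_scalar; rewrite sE.
Qed.

Lemma det_border n (T : 'M[R]_n) (t : 'cV[R]_n) (x : R) : pos_form T ->
  \det (block_mx T t t^T x%:M) = \det T * (x - (t^T *m invmx T *m t) 0 0).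
Proof.
move=> pT; rewrite det_schur ?pos_form_unit// det_mx11 /schur [X in _ * X]mxE.
by rewrite [X in _ * (X + _)]mxE eqxx mulr1n [X in _ * (_ + X)]mxE.
Qed.

(** The Schur complement of [1 + T + S] is
    [1 + x - (t - s)^T (1 + T + S)^-1 (t + s)], which the form rewrites as
    [1 + u] plus a nonnegative quantity. *)
Lemma det_border1 n (T S : 'M[R]_n) (s t : 'cV[R]_n) (x : R) :
  T^T = T -> pos_form T -> S^T = - S ->
  \det (1%:M + block_mx T t t^T x%:M + block_mx S s (- s^T) 0) =
  \det (1%:M + T + S) * (1 + (x - (t^T *m invmx T *m t) 0 0) +
    ((col_mx s t)^T *m border_form T S *m col_mx s t) 0 0).
Proof.
move=> symT pT skS; rewrite border_formE// scalar_mx_block !add_block_mx.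
rewrite !add0r addr0 det_schur; last exact/pos_form_unit/pos_form_1TS.
congr (_ * _); rewrite det_mx11 /schur [LHS]mxE [X in X + _]mxE.
rewrite ![(_%:M) 0 0]mxE eqxx !mulr1n [X in _ + X]mxE.
have -> : (t - s)^T = t^T - s^T by rewrite linearB.
by set X := _ 0 0; set Y := _ 0 0; rewrite /=; ring.
Qed.

End LeadingMinors.

(** * The radial integrand *)

Section Radial.
Variable R : realType.
Implicit Types lam sig : nat -> R[i].

Definition radial_fun n lam sig (T S : 'M[R]_n) : R[i] :=
  (\prod_(j < n)
     (rpowc (\det (ulblock T j)) (lam j.+1 - lam j.+2) /
      rpowc (\det (ulblock (1%:M + T + S) j)) (sig j.+1 - sig j.+2)))
  * (\det T ^- n)%:C.

Definition pos_radial_fun n lam sig (T S : 'M[R]_n) : R[i] :=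
  (\1_(@pos_form R n) T)%:C * radial_fun lam sig T S.

(** The exponents left on the minors of size at most [n] when the last border
    has been integrated. *)
Definition shift_exp n (l : nat -> R[i]) (c : R[i]) k : R[i] :=
  if (k <= n)%N then l k - c else 0.

(** [y] stands for the minor of size [n], whose factor [y ^ (l (n.+1) - c)] comes
    from the minor of size [n.+1]; absorbing it shifts every exponent by [c],
    because the exponents telescope. *)
Lemma prod_shift_exp n (x : 'I_n -> R) (y : R) l c :
  (forall j : 'I_n, j.+1 = n -> x j = y) -> (n = 0%N -> y = 1) ->
  (\prod_(j < n) rpowc (x j) (l j.+1 - l j.+2)) * rpowc y (l n.+1 - c) =
  \prod_(j < n) rpowc (x j) (shift_exp n l c j.+1 - shift_exp n l c j.+2).
Proof.
case: n x => [|n] x xy y1; first by rewrite !big_ord0 y1// rpow1c mulr1.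
rewrite !big_ord_recr/= xy// -mulrA -rpowcD; congr (_ * _).
  apply: eq_bigr => j _; rewrite /shift_exp !ifT ?ltnS//; last by rewrite ltnW.
  by congr (rpowc _ _); ring.
by rewrite /shift_exp leqnn ltnn; congr (rpowc _ _); ring.
Qed.

(** The factor on the left is the one that the integral over the border
    produces. Its [det T ^ (1/2)], together with the [det T ^ -1] by which
    [det T ^ -(n+1)] differs from [det T ^ -n], accounts for the shift of [lam]
    by 1/2; its [det (1 + T + S)] accounts for the shift of [sig] by 1. *)
Lemma radial_fun_border n lam sig (T S : 'M[R]_n) (s t : 'cV[R]_n) (x : R) :
  T^T = T -> pos_form T -> S^T = - S ->
  lam n.+2 = 0 -> sig n.+2 = 0 ->
  let u := x - (t^T *m invmx T *m t) 0 0 in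
  let q := ((col_mx s t)^T *m border_form T S *m col_mx s t) 0 0 in
  0 < u ->
  (Num.sqrt (\det T) * \det (1%:M + T + S))%:C *
  radial_fun lam sig (block_mx T t t^T x%:M) (block_mx S s (- s^T) 0) =
  radial_fun (shift_exp n lam 2^-1) (shift_exp n sig 1) T S *
    (rpowc u (lam n.+1 - n%:R - 1) * rpowc (1 + u + q) (- sig n.+1)).
Proof.
move=> symT pT skS lam0 sig0 u q u0.
have dT := pos_form_det pT; have dA := pos_form_det (pos_form_1TS pT skS).
have q0 : 0 <= q.
  rewrite /q; have [->|v0] := eqVneq (col_mx s t) 0; first by rewrite mulmx0 mxE.
  by rewrite ltW//; apply: border_form_pos.
have uq0 : 0 < 1 + u + q by rewrite ltr_wpDr// addr_gt0.
rewrite /radial_fun.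
have splitE (F : 'I_(n + 1) -> R[i]) : \prod_(j < n + 1) F j =
    (\prod_(j < n) F (lshift 1 j)) * F (rshift n ord0).
  by rewrite big_split_ord/= big_ord1.
rewrite splitE !ulblock_block_last det_border// det_border1//.
have -> : nat_of_ord (rshift n (ord0 : 'I_1)) = n by rewrite /= addn0.
rewrite -/u -/q lam0 sig0 !subr0.
have -> : 1%:M + block_mx T t t^T x%:M + block_mx S s (- s^T) 0 =
    block_mx (1%:M + T + S) (t + s) (t^T - s^T) (1 + x)%:M.
  by rewrite scalar_mx_block !add_block_mx !add0r addr0 -raddfD.
under eq_bigr do rewrite !ulblock_block.
rewrite !prodf_div.
have -> := esym (@prod_shift_exp n (fun j => \det (ulblock T j)) (\det T) lam 2^-1 _ _).
- have -> := esym (@prod_shift_exp n (fun j => \det (ulblock (1%:M + T + S) j))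
    (\det (1%:M + T + S)) sig 1 _ _).
  + move: (\prod_(j < n) _) => /= x1; move: (\prod_(j < n) _) => /= x2.
    rewrite (rpowcM _ dT u0) (rpowcM _ dA uq0) !rpowcB !rpowc1// rpowc_sqrt//.
    rewrite rpowc_nat// [rpowc (1 + u + q) (- _)]rpowcN exprMn addn1 !exprSr.
    have sd0 : Num.sqrt (\det T) != 0 by rewrite gt_eqF// sqrtr_gt0.
    have dE : \det T = Num.sqrt (\det T) * Num.sqrt (\det T).
      by rewrite -expr2 sqr_sqrtr// ltW.
    have un0 : u ^+ n != 0 by rewrite expf_neq0// gt_eqF.
    have dn0 : \det T ^+ n != 0 by rewrite expf_neq0// gt_eqF.
    have u'0 : u != 0 by rewrite gt_eqF.
    have e0 : \det (1%:M + T + S) != 0 by rewrite gt_eqF.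
    rewrite (invfM x2); move: (x2^-1) => x2'.
    move: (rpowc_neq0 (\det (1%:M + T + S)) (sig n.+1))
      (rpowc_neq0 (1 + u + q) (sig n.+1)).
    move: (rpowc (\det T) _) (rpowc u _) (rpowc (\det _) _) (rpowc (1 + u + q) _)
      => p1 p2 p3 p4 p30 p40.
    move: (u ^+ n) un0 (\det T ^+ n) dn0 => un un0 dn dn0.
    rewrite [in (_ * \det T * _)^-1]dE; move: (Num.sqrt _) sd0 => sd sd0.
    move: (\det _) e0 => e e0.
    rewrite !(rmorphM, fmorphV) /=; field.
    by rewrite p30 p40 !fmorph_eq0 un0 u'0 dn0 sd0 e0.
  + by move=> j jn; exact: det_ulblock_last.
  + by move=> n0; move: (1%:M + T + S); rewrite n0 => M; rewrite det_mx00.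
- by move=> j jn; exact: det_ulblock_last.
- by move=> n0; move: (T); rewrite n0 => M; rewrite det_mx00.
Qed.

End Radial.

(** * Integration of the radial integrand over its last border *)

Section Step.
Variables (R : realType) (n : nat) (lam sig : nat -> R[i]).
Local Notation mR := (measurableTypeR R).
Hypotheses (lam0 : lam n.+2 = 0) (sig0 : sig n.+2 = 0).

Let a := lam n.+1 - n%:R.

Hypotheses (a_gt0 : 0 < complex.Re a)
  (sig_gt : 0 < complex.Re (sig n.+1 - lam n.+1)).

Definition border_T (T : 'M[R]_n) (z : (n + n).+1.-tuple mR) : 'M[R]_(n + 1) :=
  let t := dsubmx (col_of_tuple (tuple_tail z)) in block_mx T t t^T (thead z)%:M.

Definition border_S (S : 'M[R]_n) (z : (n + n).+1.-tuple mR) : 'M[R]_(n + 1) :=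
  let s := usubmx (col_of_tuple (tuple_tail z)) in block_mx S s (- s^T) 0.

Definition border_const : R[i] :=
  pi%:C ^+ n * cGamma a * cGamma (sig n.+1 - lam n.+1) / cGamma (sig n.+1).

Definition border_abs_const : R :=
  pi ^+ n * absGamma (complex.Re a) * absGamma (complex.Re (sig n.+1 - lam n.+1)) /
  absGamma (complex.Re (sig n.+1)).

(** Both sides vanish unless [T] is positive, the bordered matrix being positive
    exactly when [T] is and the Schur complement [u] is positive. *)
Lemma has_cintegral_radial_border (T S : 'M[R]_n) :
  T^T = T -> S^T = - S ->
  let g := pos_radial_fun (shift_exp n lam 2^-1) (shift_exp n sig 1) T S in
  has_cintegral (lebesgue_tuple R (n + n).+1)
    (fun z => pos_radial_fun lam sig (border_T T z) (border_S S z))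
    (border_const * g) (border_abs_const * normc g).
Proof.
move=> symT skS g; rewrite /g /pos_radial_fun indicC.
case: ifPn => [|pT]; last first.
  rewrite mul0r normc0 !mulr0; apply: has_cintegral0 => z.
  rewrite indicC memNset ?mul0r// => /(pos_form_border _ _ symT)[pT' _].
  by move: pT; rewrite mem_set.
rewrite inE => pT; rewrite mul1r.
have dT := pos_form_det pT; have dA := pos_form_det (pos_form_1TS pT skS).
pose kappa := Num.sqrt (\det T) * \det (1%:M + T + S).
have kappa0 : 0 < kappa by rewrite mulr_gt0// sqrtr_gt0.
have kappaC0 : kappa%:C != 0 by rewrite fmorph_eq0 gt_eqF.
have sgaE : sig n.+1 - a - n%:R = sig n.+1 - lam n.+1.
  by rewrite /a; ring.
have sga : 0 < complex.Re (sig n.+1 - a - n%:R) by rewrite sgaE.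
have sg_gt0 : 0 < complex.Re (sig n.+1).
  have ReD (x y : R[i]) : complex.Re (x + y) = complex.Re x + complex.Re y.
    by case: x y => [? ?] [].
  have Ren : complex.Re (n%:R : R[i]) = n%:R by rewrite -(rmorph_nat (real_complex R)).
  rewrite (_ : sig n.+1 = a + (sig n.+1 - lam n.+1) + n%:R); last by rewrite /a; ring.
  by rewrite 2!ReD Ren ltr_wpDr ?ler0n// addr_gt0.
have := has_cintegralZ (kappa%:C^-1 * radial_fun (shift_exp n lam 2^-1) (shift_exp n sig 1) T S)
  (has_cintegral_border symT pT skS a_gt0 sga sg_gt0).
rewrite -/kappa sgaE.
move: (radial_fun _ _ _ _) (@radial_fun_border R n lam sig T S) => r rE.
rewrite (_ : _ * r * _ = border_const * r); last first.
  rewrite /border_const [(pi ^+ n * kappa)%:C]rmorphM rmorphXn/=.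
  by field; rewrite kappaC0 cGamma_neq0.
rewrite (_ : normc (_ * r) * _ = border_abs_const * normc r); last first.
  rewrite normcM normcV normc_real (gtr0_norm kappa0) /border_abs_const; field.
  by rewrite !gt_eqF// absGamma_gt0.
apply: has_cintegral_ext => z; rewrite /border_fun.
rewrite indicC_pos indicC; set u := thead z - _.
have uE : (border_T T z \in (@pos_form R (n + 1) : set 'M[R]_(n + 1))) = (0 < u).
  by apply/idP/idP => [/[!inE]/(pos_form_border _ _ symT)[]//|u0];
    rewrite inE; apply/(pos_form_border _ _ symT).
rewrite uE; have [u0|u0] := ltP 0 u; last by rewrite !mul0r mulr0.
rewrite !mul1r -mulrA.
have := rE (usubmx (col_of_tuple (tuple_tail z))) (dsubmx (col_of_tuple (tuple_tail z)))
  (thead z) symT pT skS lam0 sig0 u0.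
rewrite vsubmxK => /esym; rewrite -/(a - 1) => E.
rewrite [X in _ * X](_ : _ = kappa%:C * radial_fun lam sig (border_T T z) (border_S S z)).
  by rewrite mulKf.
by rewrite -E.
Qed.

End Step.

(** * Coordinates on pairs of a symmetric and a skew-symmetric matrix *)

Section MatrixCoordinates.
Variable R : realType.
Local Notation mR := (measurableTypeR R).
Local Notation leb := (@lebesgue_measure R).

(** The entry [(i, j)] holds [t_ij] when [i <= j] and [s_ji] when [j < i]: the
    coordinates of [(T, S)] fill a square array. *)
Definition coord_T n (x : 'I_n * 'I_n -> mR) : 'M[R]_n :=
  \matrix_(i, j) (if (i <= j)%N then x (i, j) else x (j, i)).

Definition coord_S n (x : 'I_n * 'I_n -> mR) : 'M[R]_n :=
  \matrix_(i, j) (if (i < j)%N then x (j, i)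
                  else if (j < i)%N then - x (i, j) else 0).

Lemma coord_T_sym n (x : 'I_n * 'I_n -> mR) : (coord_T x)^T = coord_T x.
Proof. by apply/matrixP => i j; rewrite !mxE; case: ltngtP => // /val_inj ->. Qed.

Lemma coord_S_skew n (x : 'I_n * 'I_n -> mR) : (coord_S x)^T = - coord_S x.
Proof.
by apply/matrixP => i j; rewrite !mxE; case: ltngtP; rewrite ?opprK ?oppr0.
Qed.

Lemma tuple_coords_is_lebesgue (I : finType) :
  is_lebesgue (lebesgue_tuple R #|I|) (fun x i => tnth x (enum_rank i)).
Proof.
split=> [i|A mA]; first exact: measurable_tnth.
have [_ lebE] := lebesgue_tuple_is_lebesgue R #|I|.
rewrite (_ : mkset _ = [set x | forall k, A (enum_val k) (tnth x k)]).
  rewrite (lebE (fun k => A (enum_val k)))// (reindex_onto enum_rank enum_val)/=.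
    by apply: eq_big => i; rewrite enum_rankK ?eqxx.
  by move=> i _; rewrite enum_valK.
apply/seteqP; split => x /= h k; last by have := h (enum_rank k); rewrite enum_rankK.
by have := h (enum_val k); rewrite enum_valK.
Qed.

(** The last column above the diagonal holds [t], the last row holds [s]; in the
    tuple of the border, the corner comes first and [s] precedes [t]. *)
Definition border_coord n (y : #|{: 'I_n * 'I_n}|.-tuple mR * (n + n).+1.-tuple mR)
    (p : 'I_(n + 1) * 'I_(n + 1)) : mR :=
  match fintype.split p.1, fintype.split p.2 with
  | inl i, inl j => tnth y.1 (enum_rank (i, j))
  | inl i, inr _ => tnth (tuple_tail y.2) (rshift n i)
  | inr _, inl j => tnth (tuple_tail y.2) (lshift n j)
  | inr _, inr _ => thead y.2
  end.

Lemma split_lshift m n (i : 'I_m) : fintype.split (lshift n i) = inl i.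
Proof. exact: (unsplitK (inl i)). Qed.

Lemma split_rshift m n (i : 'I_n) : fintype.split (rshift m i) = inr i.
Proof. exact: (unsplitK (inr i)). Qed.

Lemma tnth_tuple_tail n (z : n.+1.-tuple mR) i :
  tnth (tuple_tail z) i = tnth z (lift ord0 i).
Proof.
case/tupleP: z => a z; rewrite tnthS; congr tnth; exact: val_inj.
Qed.

Lemma border_coord_is_lebesgue n :
  is_lebesgue (lebesgue_tuple R #|{: 'I_n * 'I_n}| \x lebesgue_tuple R (n + n).+1)%E
    (@border_coord n).
Proof.
have mtail : measurable_fun setT (fun y : #|{: 'I_n * 'I_n}|.-tuple mR * (n + n).+1.-tuple mR
    => tuple_tail y.2).
  exact: (measurableT_comp (@measurable_behead _ _ _) measurable_snd).
split=> [[p q]|A mA].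
  rewrite /border_coord /=; case: (fintype.split p) => i; case: (fintype.split q) => j.
  - exact: (measurableT_comp (@measurable_tnth _ _ _ _) measurable_fst).
  - exact: (measurableT_comp (@measurable_tnth _ _ _ _) mtail).
  - exact: (measurableT_comp (@measurable_tnth _ _ _ _) mtail).
  - exact: (measurableT_comp (@measurable_tnth _ _ _ _) measurable_snd).
have [_ lebE] := tuple_coords_is_lebesgue ('I_n * 'I_n)%type.
have [mt _] := tuple_coords_is_lebesgue ('I_n * 'I_n)%type.
have [mt' lebE'] := lebesgue_tuple_is_lebesgue R (n + n).+1.
pose A1 (p : 'I_n * 'I_n) := A (lshift 1 p.1, lshift 1 p.2).
pose o : 'I_(n + 1) := rshift n ord0.
pose A2 (k : 'I_(n + n).+1) := match unlift ord0 k with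
  | None => A (o, o)
  | Some k' => match fintype.split k' with
    | inl j => A (o, lshift 1 j)
    | inr i => A (lshift 1 i, o)
    end
  end.
have mA2 k : measurable (A2 k).
  by rewrite /A2; case: unlift => // k'; case: fintype.split.
rewrite (_ : mkset _ = [set x | forall p, A1 p (tnth x (enum_rank p))] `*`
    [set z | forall k, A2 k (tnth z k)]); last first.
  apply/seteqP; split => -[x z] /=.
    move=> h; split => [[i j]|k].
      by have := h (lshift 1 i, lshift 1 j); rewrite /border_coord/= !split_lshift.
    rewrite /A2; case: unliftP => [k' ->|->]; last first.
      by have := h (o, o); rewrite /border_coord/= !split_rshift.
    rewrite -tnth_tuple_tail; case: (split_ordP k') => j ->.
      by have := h (o, lshift 1 j); rewrite /border_coord/= split_lshift split_rshift.
    by have := h (lshift 1 j, o); rewrite /border_coord/= split_lshift !split_rshift.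
  move=> [h1 h2] [p q]; rewrite /border_coord /=.
  case: (split_ordP p) => i ->; case: (split_ordP q) => j ->.
  - exact: (h1 (i, j)).
  - rewrite tnth_tuple_tail.
    have := h2 (lift ord0 (rshift n i)); rewrite /A2 liftK split_rshift.
    by rewrite (ord1 j).
  - rewrite tnth_tuple_tail.
    have := h2 (lift ord0 (lshift n j)); rewrite /A2 liftK split_lshift.
    by rewrite (ord1 i).
  - by have := h2 ord0; rewrite /A2 unlift_none (ord1 i) (ord1 j).
transitivity (lebesgue_tuple R #|{: 'I_n * 'I_n}|
    [set x | forall p, A1 p (tnth x (enum_rank p))] *
    lebesgue_tuple R (n + n).+1 [set z | forall k, A2 k (tnth z k)])%E.
  apply: product_measure1E; first exact: (measurable_box mt (fun p => mA _)).
  exact: (measurable_box mt' mA2).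
transitivity ((\prod_p leb (A1 p)) * \prod_k leb (A2 k))%E.
  by congr (_ * _)%E; [exact: (lebE A1 (fun p => mA _))|exact: (lebE' A2 mA2)].
have -> : (\prod_p leb (A1 p) = \prod_i \prod_j leb (A1 (i, j)))%E.
  by rewrite (pair_bigA _ (fun i j => leb (A1 (i, j)))); apply: eq_bigr => -[].
have -> : (\prod_p leb (A p) = \prod_i \prod_j leb (A (i, j)))%E.
  by rewrite (pair_bigA _ (fun i j => leb (A (i, j)))); apply: eq_bigr => -[].
have splitE (F : 'I_(n + 1) -> \bar R) :
    (\prod_j F j = (\prod_(j < n) F (lshift 1 j)) * F o)%E.
  by rewrite big_split_ord/= big_ord1.
rewrite [RHS]splitE; under [X in _ = (X * _)%E]eq_bigr do rewrite splitE.
rewrite big_split/= splitE -[RHS]muleA; congr (_ * _)%E.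
rewrite big_ord_recl big_split_ord/= {1}/A2 unlift_none muleC.
rewrite [X in _ = X]muleA; congr (_ * _)%E; rewrite muleC; congr (_ * _)%E.
  by apply: eq_bigr => i _; rewrite /A2 liftK split_rshift.
by apply: eq_bigr => i _; rewrite /A2 liftK split_lshift.
Qed.

End MatrixCoordinates.

(** * Induction on the size of the matrices *)

Section Recursion.
Variable R : realType.
Local Notation mR := (measurableTypeR R).

Lemma mx_measurable_ulblock d (Y : measurableType d) n (X : Y -> 'M[R]_n) j :
  mx_measurable X -> mx_measurable (fun y => ulblock (X y) j).
Proof. by move=> mX i k; under eq_fun do rewrite mxE; exact: mX. Qed.

Lemma measurable_pos_form d (Y : measurableType d) n (X : Y -> 'M[R]_n) :
  mx_measurable X -> (forall y, (X y)^T = X y) ->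
  measurable [set y | pos_form (X y)].
Proof.
move=> mX symX.
rewrite (_ : mkset _ =
    \bigcap_(j in setT) [set y | 0 < \det (ulblock (X y) j)]); last first.
  by apply/seteqP; split => y /=;
    [move/(pos_form_minors (symX y)) => h j _; exact: h
    |move=> h; apply/(pos_form_minors (symX y)) => j; exact: h].
apply: fin_bigcap_measurable => [|j _]; first exact: finite_finset.
rewrite (_ : mkset _ = (fun y => \det (ulblock (X y) j)) @^-1` `]0, +oo[); last first.
  by apply/seteqP; split => y /=; rewrite in_itv/= andbT.
rewrite -[X in measurable X]setTI.
have mdet := mx_measurable_det (mx_measurable_ulblock mX (j := j)).
exact: (mdet measurableT _ (measurable_itv _)).
Qed.

(** Where [T] is positive, [det T ^ -n] is a value of [rpowc], which is measurable
    in its base. *)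
Lemma cmeasurable_pos_radial_fun d (Y : measurableType d) n lam sig
    (T S : Y -> 'M[R]_n) :
  mx_measurable T -> mx_measurable S -> (forall y, (T y)^T = T y) ->
  cmeasurable (fun y => pos_radial_fun lam sig (T y) (S y)).
Proof.
move=> mT mS symT.
have E : (fun y => pos_radial_fun lam sig (T y) (S y)) = (fun y =>
    (\1_[set y | pos_form (T y)] y)%:C * ((\prod_(j < n)
     (rpowc (\det (ulblock (T y) j)) (lam j.+1 - lam j.+2) *
      rpowc (\det (ulblock (1%:M + T y + S y) j)) (- (sig j.+1 - sig j.+2)))) *
      rpowc (\det (T y)) (- n%:R))).
  apply/funext => y; rewrite /pos_radial_fun !indicC.
  case: ifPn => [|_]; last by rewrite !mul0r.
  rewrite inE => pT; rewrite !mul1r /radial_fun; congr (_ * _).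
    by apply: eq_bigr => j _; rewrite rpowcN.
  by rewrite rpowcN rpowc_nat ?fmorphV//; exact: pos_form_det.
rewrite E; apply: cmeasurableM.
  by apply: cmeasurable_indic; exact: measurable_pos_form.
apply: cmeasurableM; last by apply: cmeasurable_rpowc; exact: mx_measurable_det.
apply: cmeasurable_prod => j; apply: cmeasurableM; apply: cmeasurable_rpowc.
  by apply: mx_measurable_det; exact: mx_measurable_ulblock.
apply: mx_measurable_det; apply: mx_measurable_ulblock.
by apply: mx_measurableD => //; apply: mx_measurableD => //.
Qed.

Lemma coord_measurable_radial n lam sig :
  coord_measurable (fun x : 'I_n * 'I_n -> mR =>
    pos_radial_fun lam sig (coord_T x) (coord_S x)).
Proof.
apply: cmeasurable_pos_radial_fun => [i j|i j|x]; last exact: coord_T_sym.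
- under eq_fun do rewrite mxE.
  by case: (i <= j)%N; exact: measurable_tnth.
- under eq_fun do rewrite mxE.
  case: (i < j)%N; first exact: measurable_tnth.
  case: (j < i)%N; last exact: measurable_cst.
  by apply: measurableT_comp => //; exact: measurable_tnth.
Qed.

Lemma coord_T_border n
    (y : #|{: 'I_n * 'I_n}|.-tuple mR * (n + n).+1.-tuple mR) :
  coord_T (border_coord y) =
  border_T (coord_T (fun p : 'I_n * 'I_n => tnth y.1 (enum_rank p))) y.2.
Proof.
apply/matrixP => i j; rewrite mxE /border_coord /border_T /=.
case: (split_ordP i) => i' ->; case: (split_ordP j) => j' ->.
- by rewrite block_mxEul mxE.
- rewrite block_mxEur !mxE ifT//.
  by rewrite /= ltnW// ltn_addr.
- rewrite block_mxEdl !mxE ifF//.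
  by rewrite /= leqNgt ltn_addr.
- by rewrite block_mxEdr mxE (ord1 i') (ord1 j') eqxx mulr1n leqnn.
Qed.

Lemma coord_S_border n
    (y : #|{: 'I_n * 'I_n}|.-tuple mR * (n + n).+1.-tuple mR) :
  coord_S (border_coord y) =
  border_S (coord_S (fun p : 'I_n * 'I_n => tnth y.1 (enum_rank p))) y.2.
Proof.
apply/matrixP => i j; rewrite mxE /border_coord /border_S /=.
case: (split_ordP i) => i' ->; case: (split_ordP j) => j' ->.
- by rewrite block_mxEul mxE.
- rewrite block_mxEur !mxE ifT//.
  by rewrite /= ltn_addr.
- rewrite block_mxEdl !mxE ifF ?ifT//=; first by rewrite ltn_addr.
  by rewrite ltnNge ltnW// ltn_addr.
- by rewrite block_mxEdr mxE (ord1 i') (ord1 j') ltnn.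
Qed.

(** Absolute convergence is the existence of [w]; positivity of [T] stands in the
    integrand instead of in the domain. *)
Definition radial_formula n : Prop := forall lam sig : nat -> R[i],
  lam n.+1 = 0 -> sig n.+1 = 0 ->
  (forall k : nat, (1 <= k <= n)%N -> 0 < complex.Re (lam k - (n + k)%:R / 2 + 1)) ->
  (forall k : nat, (1 <= k <= n)%N ->
     0 < complex.Re (sig k - lam k - (n%:R - k%:R) / 2)) ->
  exists w, has_cintegral (lebesgue_tuple R #|{: 'I_n * 'I_n}|)
    (fun x => let c p := tnth x (enum_rank p) in
       pos_radial_fun lam sig (coord_T c) (coord_S c))
    (\prod_(1 <= k < n.+1)
      (pi%:C ^+ k.-1 * cGamma (lam k - (n + k)%:R / 2 + 1)
        * cGamma (sig k - lam k - (n%:R - k%:R) / 2)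
       / cGamma (sig k - n%:R + k%:R))) w.

Lemma radial_formula0 : radial_formula 0.
Proof.
move=> lam sig _ _ _ _; exists 1; rewrite big_nil.
have [_ lebE] := tuple_coords_is_lebesgue R ('I_0 * 'I_0)%type.
have L : lebesgue_tuple R #|{: 'I_0 * 'I_0}| setT = 1%E.
  have := lebE (fun=> setT) (fun=> measurableT).
  rewrite big1 => [<-|[[]//]]; congr (lebesgue_tuple _ _ _).
  by apply/seteqP; split.
rewrite -(rmorph1 (real_complex R)).
apply: has_cintegral_ext (has_cintegral_ge0 (f := fun=> 1) _ _ _) => //; last first.
  by rewrite integral_cst//= L mule1.
move=> x /=; rewrite /pos_radial_fun /radial_fun big_ord0 mul1r expr0 invr1 mulr1.
rewrite indicE mem_set// => v; by rewrite [v]flatmx0 eqxx.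
Qed.

(** The shifted exponents satisfy the hypotheses at size [n] and yield the factors
    of index at most [n], unchanged; the border yields the last factor. *)
Lemma radial_formulaS n : radial_formula n -> radial_formula n.+1.
Proof.
move=> IH lam sig lam0 sig0 lamc sigc.
have n1 : (1 <= n.+1 <= n.+1)%N by rewrite leqnn.
have a_gt0 : 0 < complex.Re (lam n.+1 - n%:R).
  suff -> : lam n.+1 - n%:R = lam n.+1 - (n.+1 + n.+1)%:R / 2 + 1 by exact: lamc.
  by rewrite natrD -natr1; field.
have sig_gt : 0 < complex.Re (sig n.+1 - lam n.+1).
  by have := sigc _ n1; rewrite subrr mul0r subr0.
have lam'E k : (1 <= k <= n)%N ->
    shift_exp n lam 2^-1 k - (n + k)%:R / 2 + 1 = lam k - (n.+1 + k)%:R / 2 + 1.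
  by move=> /andP[_ kn]; rewrite /shift_exp kn addSn -natr1; field.
have sig'E k : (1 <= k <= n)%N ->
    shift_exp n sig 1 k - shift_exp n lam 2^-1 k - (n%:R - k%:R) / 2 =
    sig k - lam k - (n.+1%:R - k%:R) / 2.
  by move=> /andP[_ kn]; rewrite /shift_exp kn -[n.+1%:R]natr1; field.
have sig''E k : (1 <= k <= n)%N ->
    shift_exp n sig 1 k - n%:R + k%:R = sig k - n.+1%:R + k%:R.
  by move=> /andP[_ kn]; rewrite /shift_exp kn -[n.+1%:R]natr1; ring.
have le1 k : (1 <= k <= n)%N -> (1 <= k <= n.+1)%N.
  by move=> /andP[-> /leqW].
have [||||w Hw] := IH (shift_exp n lam 2^-1) (shift_exp n sig 1).
- by rewrite /shift_exp ltnn.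
- by rewrite /shift_exp ltnn.
- by move=> k kn; rewrite lam'E// lamc// le1.
- by move=> k kn; rewrite sig'E// sigc// le1.
exists (border_abs_const n lam sig * w).
have -> : \prod_(1 <= k < n.+2)
      (pi%:C ^+ k.-1 * cGamma (lam k - (n.+1 + k)%:R / 2 + 1)
        * cGamma (sig k - lam k - (n.+1%:R - k%:R) / 2)
       / cGamma (sig k - n.+1%:R + k%:R)) =
    border_const n lam sig * \prod_(1 <= k < n.+1)
      (pi%:C ^+ k.-1 * cGamma (shift_exp n lam 2^-1 k - (n + k)%:R / 2 + 1)
        * cGamma (shift_exp n sig 1 k - shift_exp n lam 2^-1 k - (n%:R - k%:R) / 2)
       / cGamma (shift_exp n sig 1 k - n%:R + k%:R)).
  rewrite big_nat_recr//= mulrC; congr (_ * _).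
    rewrite /border_const; congr (_ * cGamma _ * cGamma _ / cGamma _).
    + by rewrite natrD -natr1; field.
    + by rewrite subrr mul0r subr0.
    + by rewrite subrK.
  by apply: eq_big_nat => k kn; rewrite lam'E// sig'E// sig''E.
set v := border_const n lam sig * _.
suff : has_cintegral (lebesgue_tuple R #|{: 'I_(n + 1) * 'I_(n + 1)}|)
    (fun x => let c p := tnth x (enum_rank p) in
       pos_radial_fun lam sig (coord_T c) (coord_S c)) v (border_abs_const n lam sig * w).
  by rewrite addn1.
have mf := @coord_measurable_radial (n + 1) lam sig.
apply: (has_cintegral_coords (border_coord_is_lebesgue R n)
  (tuple_coords_is_lebesgue R ('I_(n + 1) * 'I_(n + 1))%type) mf).
rewrite {}/v.
apply: has_cintegral_fubini Hw.
  apply: (coord_measurable_comp (c := @border_coord R n) _ mf).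
  by case: (border_coord_is_lebesgue R n).
move=> x /=; set c := fun p => tnth x (enum_rank p).
have := has_cintegral_radial_border lam0 sig0 a_gt0 sig_gt (coord_T_sym c) (coord_S_skew c).
by apply: has_cintegral_ext => z; rewrite coord_T_border coord_S_border.
Qed.

Lemma has_cintegral_radial n : radial_formula n.
Proof.
by elim: n => [|n]; [exact: radial_formula0|exact: radial_formulaS].
Qed.

End Recursion.

(** * Coordinates stored on the upper triangles *)

Section SymSkew.
Variables (R : realType) (n : nat).
Local Notation mR := (measurableTypeR R).
Local Notation leb := (@lebesgue_measure R).

Lemma mx_of_coords_val (A : {set 'I_n * 'I_n}) (x : #|A|.-tuple R) k :
  mx_of_coords x (enum_val k).1 (enum_val k).2 = tnth x k.
Proof.
rewrite /mx_of_coords summxE (bigD1 k)//= !mxE !eqxx mulr1 big1 ?addr0// => l lk.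
rewrite !mxE -xpair_eqE -!surjective_pairing (inj_eq enum_val_inj) eq_sym.
by rewrite (negbTE lk) mulr0.
Qed.

Lemma mx_of_coords_off (A : {set 'I_n * 'I_n}) (x : #|A|.-tuple R) i j :
  (i, j) \notin A -> mx_of_coords x i j = 0.
Proof.
move=> ijA; rewrite /mx_of_coords summxE big1// => k _; rewrite !mxE -xpair_eqE.
rewrite -surjective_pairing; case: eqP => [E|_]; last by rewrite mulr0.
by move: ijA; rewrite E enum_valP.
Qed.

Local Notation TS :=
  (#|upper n|.-tuple mR * #|strict_upper n|.-tuple mR)%type.

Definition sym_skew_coord (x : TS) (p : 'I_n * 'I_n) : mR :=
  if p \in upper n then mx_of_coords x.1 p.1 p.2 else mx_of_coords x.2 p.2 p.1.

Lemma coord_T_sym_skew x : coord_T (sym_skew_coord x) = sym_mx x.1.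
Proof.
apply/matrixP => i j; rewrite !mxE /sym_skew_coord !inE /=.
by case: leqP => // /ltnW ->.
Qed.

Lemma coord_S_sym_skew x : coord_S (sym_skew_coord x) = skew_mx x.2.
Proof.
apply/matrixP => i j; rewrite !mxE /sym_skew_coord !inE /=.
case: (ltngtP i j) => ij.
- by rewrite (@mx_of_coords_off _ _ j i) ?subr0// inE/= -leqNgt ltnW.
- by rewrite (@mx_of_coords_off _ _ i j) ?sub0r// inE/= -leqNgt ltnW.
- by rewrite (val_inj ij) subrr.
Qed.

(** The upper triangle and the transposed strict one partition the square. *)
Lemma sym_skew_coord_is_lebesgue : is_lebesgue (lebesgue_TS R n) sym_skew_coord.
Proof.
have swap_val (k : 'I_#|strict_upper n|) :
    ((enum_val k).2, (enum_val k).1) \in upper n = false.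
  by have := enum_valP k; rewrite !inE /= ltnNge => /negbTE.
have cU (x : TS) k : sym_skew_coord x (enum_val k) = tnth x.1 k.
  by rewrite /sym_skew_coord enum_valP mx_of_coords_val.
have cL (x : TS) k :
    sym_skew_coord x ((enum_val k).2, (enum_val k).1) = tnth x.2 k.
  by rewrite /sym_skew_coord swap_val mx_of_coords_val.
have caseUL (P : 'I_n * 'I_n -> Prop) : (forall k : 'I_#|upper n|, P (enum_val k)) ->
    (forall k : 'I_#|strict_upper n|, P ((enum_val k).2, (enum_val k).1)) ->
    forall p, P p.
  move=> PU PL [i j]; case: (leqP i j) => ij.
    have pU : (i, j) \in upper n by rewrite inE.
    by have := PU (enum_rank_in pU (i, j)); rewrite enum_rankK_in.
  have pL : (j, i) \in strict_upper n by rewrite inE.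
  by have := PL (enum_rank_in pL (j, i)); rewrite enum_rankK_in.
split=> [|A mA].
  apply: caseUL => k.
    under eq_fun do rewrite cU.
    exact: (measurableT_comp (@measurable_tnth _ _ _ _) measurable_fst).
  under eq_fun do rewrite cL.
  exact: (measurableT_comp (@measurable_tnth _ _ _ _) measurable_snd).
rewrite (_ : mkset _ =
    [set t : #|upper n|.-tuple mR | forall k, A (enum_val k) (tnth t k)] `*`
    [set s : #|strict_upper n|.-tuple mR |
       forall k, A ((enum_val k).2, (enum_val k).1) (tnth s k)]); last first.
  apply/seteqP; split => x /=.
    move=> h; split => k; last by rewrite -cL.
    by rewrite -cU.
  by move=> [hU hL]; apply: caseUL => k; rewrite ?cU ?cL.
have [mU lebU] := lebesgue_tuple_is_lebesgue R #|upper n|.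
have [mL lebL] := lebesgue_tuple_is_lebesgue R #|strict_upper n|.
transitivity (lebesgue_tuple R #|upper n|
    [set t | forall k, A (enum_val k) (tnth t k)] *
  lebesgue_tuple R #|strict_upper n|
    [set s | forall k, A ((enum_val k).2, (enum_val k).1) (tnth s k)])%E.
  apply: product_measure1E.
    exact: (measurable_box (A := fun k => A (enum_val k)) mU).
  exact: (measurable_box (A := fun k => A ((enum_val k).2, (enum_val k).1)) mL).
rewrite (lebU (fun k => A (enum_val k)))//.
rewrite (lebL (fun k => A ((enum_val k).2, (enum_val k).1)))//.
rewrite -(big_enum_val (A := mem (upper n)) (fun p => leb (A p))).
rewrite -(big_enum_val (A := mem (strict_upper n)) (fun p => leb (A (p.2, p.1)))).
rewrite [RHS](bigID (mem (upper n)))/=; congr (_ * _)%E.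
rewrite [RHS](reindex_inj (h := fun p : 'I_n * 'I_n => (p.2, p.1)))/=.
  by apply: eq_bigl => -[i j]; rewrite !inE /= -ltnNge.
by move=> [i j] [i' j'] [-> ->].
Qed.

Lemma sym_mx_sym (t : #|upper n|.-tuple R) : (sym_mx t)^T = sym_mx t.
Proof.
apply/matrixP => i j; rewrite !mxE.
by case: ltngtP => // /val_inj ->.
Qed.

Lemma skew_mx_skew (s : #|strict_upper n|.-tuple R) : (skew_mx s)^T = - skew_mx s.
Proof. by rewrite /skew_mx linearB /= trmxK opprB. Qed.

Lemma dissipative_pos_form (T S : 'M[R]_n) : T^T = T -> S^T = - S ->
  dissipative (T + S) <-> pos_form T.
Proof.
move=> symT skS; rewrite /dissipative /posdefmx.
have -> : T + S + (T + S)^T = 2 *: T.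
  by rewrite raddfD/= symT skS addrACA subrr addr0 scaler_nat mulr2n.
have E v : (v^T *m (2 *: T) *m v) 0 0 = 2 * (v^T *m T *m v) 0 0.
  by rewrite -scalemxAr -scalemxAl mxE.
split=> [[_ pT] v v0|pT]; last split => [|v v0].
- by have := pT v v0; rewrite E pmulr_rgt0.
- by rewrite linearZ/= symT.
- by rewrite E pmulr_rgt0//; exact: pT.
Qed.

End SymSkew.

Theorem mainTheorem4 (R : realType) (n : nat) (lam sig : nat -> R[i])
    (n_ge1 : (1 <= n)%N)
    (lam_last : lam n.+1 = 0) (sig_last : sig n.+1 = 0)
    (lam_cond : forall k : nat, (1 <= k <= n)%N ->
       0 < complex.Re (lam k - (n + k)%:R / 2 + 1))
    (sig_cond : forall k : nat, (1 <= k <= n)%N ->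
       0 < complex.Re (sig k - lam k - (n%:R - k%:R) / 2)) :
  let W := [set x | dissipative (sym_mx x.1 + skew_mx x.2)] in
  let F (x : #|upper n|.-tuple (measurableTypeR R) *
             #|strict_upper n|.-tuple (measurableTypeR R)) : R[i] :=
    let T := sym_mx x.1 in
    let S := skew_mx x.2 in
    (\prod_(j < n)
       (rpowc (\det (ulblock T j)) (lam j.+1 - lam j.+2) /
        rpowc (\det (ulblock (1%:M + T + S) j)) (sig j.+1 - sig j.+2)))
    * (\det T ^- n)%:C in
  cintegrable (lebesgue_TS R n) W F /\
  cintegral (lebesgue_TS R n) W F =
    \prod_(1 <= k < n.+1)
      (pi%:C ^+ k.-1 * cGamma (lam k - (n + k)%:R / 2 + 1)
        * cGamma (sig k - lam k - (n%:R - k%:R) / 2)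
       / cGamma (sig k - n%:R + k%:R)).
Proof.
move=> W F.
have WE : W = [set x | pos_form (sym_mx x.1)].
  apply/seteqP; split => x /=;
    by move/(dissipative_pos_form (sym_mx_sym x.1) (skew_mx_skew x.2)).
have [w Hw] := has_cintegral_radial lam_last sig_last lam_cond sig_cond.
have cL := sym_skew_coord_is_lebesgue R n.
have mW : measurable W.
  rewrite WE; apply: measurable_pos_form => [i j|x]; last exact: sym_mx_sym.
  under eq_fun do rewrite -coord_T_sym_skew mxE.
  by case: (i <= j)%N; exact: (is_lebesgue_measurable cL).
apply: (has_cintegral_restrict (mu := lebesgue_TS R n) (f := F) mW (w := w)).
have mf := @coord_measurable_radial R n lam sig.
have := has_cintegral_coords (tuple_coords_is_lebesgue R ('I_n * 'I_n)%type) cL mf Hw.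
apply: has_cintegral_ext => x.
by rewrite coord_T_sym_skew coord_S_sym_skew /pos_radial_fun WE; congr (_%:C * _).
Qed.
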